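(* Suppose $T^3$ acts effectively on a connected $7$-manifold $M$ with $\mathrm{G}_2$-structure $\varphi$, preserving $\varphi$, so that the orbits are isotropic: $\varphi|_{\Lambda^3\xi_p}=0$ for all $p\in M$. Then each isotropy group is connected and of dimension at most two; hence it is trivial, a circle, or isomorphic to $T^2$.
   Context: On $\mathbb R^7$ with dual basis $e^1,\dots,e^7$ put $\varphi_0=e^{123}-e^1(e^{45}+e^{67})-e^2(e^{46}+e^{75})-e^3(e^{47}+e^{56})$ (wedge signs suppressed). A $\mathrm{G}_2$-structure on a $7$-manifold $M$ is a $3$-form $\varphi$ pointwise linearly equivalent to $\varphi_0$ (not assumed closed or co-closed here). For $p\in M$, $\xi_p\subset T_pM$ denotes the tangent space at $p$ to the $T^3$-orbit, i.e. the span of the values at $p$ of the fundamental vector fields of the action. *)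

(* Defs.v *)
From HB Require Import structures.
From mathcomp Require Import all_boot all_order all_algebra.
From mathcomp Require Import generic_quotient ring_quotient.
From mathcomp Require Import all_classical all_reals all_analysis.

Set Implicit Arguments.
Unset Strict Implicit.
Unset Printing Implicit Defensive.

Import Order.TTheory GRing.Theory Num.Theory numFieldNormedType.Exports.

Local Open Scope classical_set_scope.
Local Open Scope ring_scope.

(* C^k and C^oo maps on an open set U.  The maps are total; only their germs   *)
(* at the points of U matter, since U is always open when this is used.        *)
Fixpoint Ck_on (R : realType) (V W : normedModType R) (k : nat) (U : set V)
    (f : V -> W) : Prop :=
  if k is k'.+1 then
    (forall x, U x -> differentiable f x) /\
    (forall v : V, Ck_on k' U (fun x => 'd f x v))
  else forall x, U x -> {for x, continuous f}.

Definition smooth_on (R : realType) (V W : normedModType R) (U : set V)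
  (f : V -> W) : Prop := forall k, Ck_on k U f.

Record chart (R : realType) (n : nat) (M : topologicalType) := Chart {
  chart_dom : set M;
  chart_map :> M -> 'rV[R]_n;
  chart_inv : 'rV[R]_n -> M;
  chart_dom_open : open chart_dom;
  chart_cod_open : open (chart_map @` chart_dom);
  chartK : forall p, chart_dom p -> chart_inv (chart_map p) = p;
  chart_map_continuous :
    forall p, chart_dom p -> {for p, continuous chart_map};
  chart_inv_continuous :
    forall x, (chart_map @` chart_dom) x -> {for x, continuous chart_inv}
}.

(* The atlas need not be maximal: any atlas determines the smooth structure.   *)
(* The preferred chart chart_at p is auxiliary data, used only to present the  *)
(* tangent spaces below.                                                       *)
Record manifold (R : realType) (n : nat) := Manifold {
  carrier :> topologicalType;
  manifold_hausdorff : hausdorff_space carrier;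
  manifold_second_countable : second_countable (T := carrier);
  atlas : set (chart R n carrier);
  chart_at : carrier -> chart R n carrier;
  chart_at_atlas : forall p, atlas (chart_at p);
  chart_at_dom : forall p, chart_dom (chart_at p) p;
  atlas_compatible : forall c1 c2 : chart R n carrier, atlas c1 -> atlas c2 ->
    smooth_on (c1 @` (chart_dom c1 `&` chart_dom c2)) (c2 \o chart_inv c1)
}.

Section Manifolds.
Variables (R : realType) (n : nat) (M : manifold R n).

(* T_pM is R^n, a vector being identified with its components in the preferred *)
(* chart at p; the components in another chart c are obtained from the         *)
(* derivative of the change of coordinates.                                    *)
Definition tangent (p : M) : Type := 'rV[R]_n.

(* The vector of T_pM whose components in the chart c are u. *)
Definition of_coord (c : chart R n M) (p : M) (u : 'rV[R]_n) : tangent p :=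
  'd (chart_at p \o chart_inv c) (c p) u.

Definition tangent_map (f : M -> M) (p : M) (v : tangent p) : tangent (f p) :=
  'd (chart_at (f p) \o f \o chart_inv (chart_at p)) (chart_at p p) v.

Definition field3 := forall p : M, tangent p -> tangent p -> tangent p -> R.

Definition trilinear (p : M) (w : tangent p -> tangent p -> tangent p -> R) :=
  [/\ forall u v, scalar (fun x : 'rV[R]_n => w x u v),
      forall u v, scalar (fun x : 'rV[R]_n => w u x v)
    & forall u v, scalar (fun x : 'rV[R]_n => w u v x)].

Definition alternating3 (p : M) (w : tangent p -> tangent p -> tangent p -> R) :=
  forall u v, [/\ w u u v = 0, w u v u = 0 & w u v v = 0].

Definition smooth_field3 (w : field3) := forall c : chart R n M, atlas c ->
  forall u1 u2 u3 : 'rV[R]_n,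
  smooth_on (W := R^o) (c @` chart_dom c) (fun x => let p := chart_inv c x in
    w p (of_coord c p u1) (of_coord c p u2) (of_coord c p u3)).

Definition is_3form (w : field3) :=
  [/\ forall p, trilinear (w p), forall p, alternating3 (w p)
    & smooth_field3 w].

(* f^* w = w *)
Definition preserves (f : M -> M) (w : field3) := forall (p : M) (u1 u2 u3 : tangent p),
  w (f p) (tangent_map f u1) (tangent_map f u2) (tangent_map f u3) = w p u1 u2 u3.

End Manifolds.

Section G2.
Variable R : realType.

(* e^{ijk} = e^i /\ e^j /\ e^k with the indices running from 1 to 7, normalized *)
(* by e^{123}(e_1, e_2, e_3) = 1.                                              *)
Definition e3 (i j k : nat) (u v w : 'rV[R]_7) : R :=
  \det (\matrix_(a < 3, b < 3)
    (nth 0 [:: u; v; w] b) ord0 (inord (nth 0%N [:: i; j; k] a).-1)).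

(* e^1(e^{45} + e^{67}) etc. are expanded. *)
Definition phi0 (u v w : 'rV[R]_7) : R :=
  e3 1 2 3 u v w
  - (e3 1 4 5 u v w + e3 1 6 7 u v w)
  - (e3 2 4 6 u v w + e3 2 7 5 u v w)
  - (e3 3 4 7 u v w + e3 3 5 6 u v w).

Definition G2_structure (M : manifold R 7) (phi : field3 M) :=
  is_3form phi /\
  forall p : M, exists2 A : 'M[R]_7, A \in unitmx &
    forall u v w : 'rV[R]_7, phi p u v w = phi0 (u *m A) (v *m A) (w *m A).

End G2.

(* The torus T^n = R^n / Z^n, an additive group with the quotient topology. *)
Section Torus.
Variables (R : realType) (n : nat).

Definition int_lattice (x : 'rV[R]_n) : bool :=
  [forall j, x ord0 j \is a Num.int].

Fact int_lattice_zmod_closed : zmod_closed int_lattice.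
Proof.
split=> [|x y /forallP xZ /forallP yZ]; apply/forallP => j.
  by rewrite mxE rpred0.
by rewrite !mxE rpredB.
Qed.

HB.instance Definition _ :=
  GRing.isZmodClosed.Build 'rV[R]_n int_lattice int_lattice_zmod_closed.

Definition torus : Type :=
  Quotient.quot (Algebra.ZmodClosed.clone 'rV[R]_n int_lattice _).

HB.instance Definition _ := GRing.Zmodule.on torus.
HB.instance Definition _ := Quotient.on torus.

Definition torus_exp (x : 'rV[R]_n) : torus := (\pi_torus x)%qT.

Definition torus_open (U : set torus) := open (torus_exp @^-1` U).

Fact torus_openT : torus_open setT.
Proof. exact: openT. Qed.

Fact torus_openI : setI_closed torus_open.
Proof. by move=> U V; exact: openI. Qed.

Fact torus_open_bigU (I : Type) (f : I -> set torus) :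
  (forall i, torus_open (f i)) -> torus_open (\bigcup_i f i).
Proof.
by move=> fo; rewrite /torus_open preimage_bigcup; apply: bigcup_open => i _; exact: fo.
Qed.

HB.instance Definition _ :=
  isOpenTopological.Build torus torus_openT torus_openI torus_open_bigU.

(* The Lie algebra of T^n is R^n, with exponential map torus_exp. *)
Definition lie_algebra (H : set torus) : set 'rV[R]_n :=
  [set X | forall s : R, H (torus_exp (s *: X))].

(* The dimension of a closed subgroup H is that of its Lie algebra. *)
Definition lie_dim (H : set torus) (d : nat) := exists V : {vspace 'rV[R]_n},
  (forall X, X \in V <-> lie_algebra H X) /\ \dim V = d.

End Torus.

(* The subgroup H of T^n is isomorphic to T^k, as a topological group with the *)
(* subspace topology; g is the inverse isomorphism.  (Continuous homomorphisms *)
(* of Lie groups are smooth.)                                                  *)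
Definition isomorphic_to_torus (R : realType) (n : nat) (H : set (torus R n))
    (k : nat) := exists (f : torus R k -> torus R n) (g : torus R n -> torus R k),
  [/\ {morph f : s t / s + t}, f @` setT = H, cancel f g, continuous f
    & {within H, continuous g}].

Section Actions.
Variables (R : realType) (k n : nat) (M : manifold R n).
Implicit Type act : torus R k -> M -> M.

Definition is_action act :=
  (forall p, act 0 p = p) /\ (forall s t p, act (s + t) p = act s (act t p)).

(* Smoothness of T^k x M -> M: continuity, and smoothness of all local         *)
(* expressions, where the inverses of the local charts of T^k = R^k / Z^k are  *)
(* the restrictions of torus_exp.                                              *)
Definition is_smooth act :=
  continuous (fun z : torus R k * M => act z.1 z.2) /\
  forall c c' : chart R n M, atlas c -> atlas c' ->
  smooth_on
    [set z : 'rV[R]_k * 'rV[R]_n | (c @` chart_dom c) z.2 /\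
       chart_dom c' (act (torus_exp z.1) (chart_inv c z.2))]
    (fun z => c' (act (torus_exp z.1) (chart_inv c z.2))).

Definition effective act := forall t, (forall p, act t p = p) -> t = 0.

Definition isotropy act (p : M) : set (torus R k) := [set t | act t p = p].

Definition fundamental_field act (X : 'rV[R]_k) (p : M) : tangent p :=
  derive1 (fun s : R => chart_at p (act (torus_exp (s *: X)) p)) 0.

(* xi_p, as a subset of T_pM *)
Definition orbit_tangent act (p : M) : set (tangent p) :=
  [set v | exists (m : nat) (a : 'I_m -> R) (X : 'I_m -> 'rV[R]_k),
    v = \sum_(i < m) a i *: (fundamental_field act (X i) p : 'rV[R]_n)].

End Actions.

Arguments orbit_tangent {R k n M} act p _.

(* Main.v *)
Require Import Defs.
From mathcomp Require Import all_boot all_order all_algebra.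
From mathcomp Require Import generic_quotient.
From mathcomp Require Import all_classical all_reals all_analysis.
From mathcomp Require Import ring lra complex.

Set Implicit Arguments.
Unset Strict Implicit.
Unset Printing Implicit Defensive.

Import Order.TTheory GRing.Theory Num.Theory numFieldNormedType.Exports.

Local Open Scope classical_set_scope.
Local Open Scope ring_scope.

(** The isotropy group H of p fixes the tangent space of the orbit of p, since
    the torus is abelian, and it preserves the form phi at p. It is determined
    by its action on the tangent space of M at p ([faithful_iso_rep]): an
    element acting trivially there moves nearby points by nearly constant
    steps, so that its multiples could not stay in a compact group unless it
    fixes a neighbourhood of p; then it acts trivially on the connected
    manifold M, and is zero by effectiveness. So H is an abelian subgroup of
    the group G2 of linear maps preserving phi0.

    Such maps preserve the Euclidean metric ([G2_ortho]), hence the cross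
    product defined by phi0. Orthonormal vectors u, v, w with phi0(u, v, w) = 0
    generate R^7 under the cross product, so only the identity fixes all three
    ([G2_triple_rigid]). If u is fixed by H, the product with u is a complex
    structure on its orthogonal that commutes with H, and H has common complex
    eigenvectors v and w such that (u, v, w) is such a triple. The two
    corresponding characters then determine the elements of H. This is the
    fact that G2 has rank two. When v is also fixed, only the second character
    remains, and when the orbit has dimension three the isotropy condition
    makes its tangent space spanned by such a triple, so H is trivial. A fixed
    u is a tangent vector of the orbit, except when p is fixed by the whole
    torus; in that case it comes from divisibility ([G2_exists_fixed]).

    In all cases there are m characters with m at most the dimension of H and
    at most two. Being jointly injective on H they are jointly injective on
    its Lie algebra, so m is the dimension of H and the derivatives of the
    characters form an isomorphism onto R^m. Every value of the characters is
    then taken on the exponential of the Lie algebra, which is therefore all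
    of H, and the lattice of periods corresponds to Z^m: H is a torus of
    dimension m, in particular connected ([torus_structure]). *)

(** * The Euclidean inner product on row vectors *)

Section Dot.
Variables (R : realType) (n : nat).
Implicit Types u v w : 'rV[R]_n.

Definition dot u v : R := (u *m v^T) 0 0.
Lemma dotE u v : dot u v = \sum_i u 0 i * v 0 i.
Proof. by rewrite /dot mxE; apply: eq_bigr => i _; rewrite mxE. Qed.

Lemma dotC u v : dot u v = dot v u.
Proof. by rewrite !dotE; apply: eq_bigr => i _; rewrite mulrC. Qed.

Lemma dotDl u v w : dot (u + v) w = dot u w + dot v w.
Proof. by rewrite /dot mulmxDl mxE. Qed.

Lemma dotZl a u v : dot (a *: u) v = a * dot u v.
Proof. by rewrite /dot -scalemxAl mxE. Qed.

Lemma dotNl u v : dot (- u) v = - dot u v.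
Proof. by rewrite /dot mulNmx mxE. Qed.

Lemma dot0l v : dot 0 v = 0.
Proof. by rewrite /dot mul0mx mxE. Qed.

Lemma dotDr u v w : dot u (v + w) = dot u v + dot u w.
Proof. by rewrite dotC dotDl !(dotC u). Qed.

Lemma dotZr a u v : dot u (a *: v) = a * dot u v.
Proof. by rewrite dotC dotZl dotC. Qed.

Lemma dotNr u v : dot u (- v) = - dot u v.
Proof. by rewrite dotC dotNl dotC. Qed.

Lemma dot0r v : dot v 0 = 0.
Proof. by rewrite dotC dot0l. Qed.

Lemma dot_ge0 u : 0 <= dot u u.
Proof. by rewrite dotE sumr_ge0// => i _; exact: sqr_ge0. Qed.

Lemma dot_eq0 u : (dot u u == 0) = (u == 0).
Proof.
apply/idP/eqP => [|->]; last by rewrite dot0l.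
rewrite dotE psumr_eq0 => [/allP u0|i _]; last exact: sqr_ge0.
apply/rowP => i; rewrite mxE; apply/eqP.
by have := u0 i (mem_index_enum _); rewrite -expr2 sqrf_eq0.
Qed.

Lemma dot_delta u i : dot u (delta_mx 0 i) = u 0 i.
Proof.
rewrite dotE (bigD1 i)//= !mxE !eqxx mulr1 big1 ?addr0// => j /negPf ji.
by rewrite mxE ji andbF mulr0.
Qed.

Lemma dot_inj u v : (forall w, dot u w = dot v w) -> u = v.
Proof. by move=> uv; apply/rowP => i; rewrite -!dot_delta. Qed.

Lemma exists_unit u : u != 0 -> exists a : R, dot (a *: u) (a *: u) = 1.
Proof.
move=> u0; have d0 : 0 < dot u u by rewrite lt_def dot_ge0 dot_eq0 u0.
exists (Num.sqrt (dot u u))^-1.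
rewrite dotZl dotZr mulrA -expr2 exprVn sqr_sqrtr ?ltW// mulVf//.
by rewrite gt_eqF.
Qed.
End Dot.

(** * The cross product of R^7 *)

Section Cross.
Variable R : realType.
Implicit Types u v w : 'rV[R]_7.

(** The Sarrus formula. Indexing the entries by natural numbers through [inord]
    keeps every later coordinate computation free of ordinals, so that [ring]
    can finish it. *)
Lemma det3 (M : 'M[R]_3) (m := fun i j : nat => M (inord i) (inord j)) :
  \det M = m 0%N 0%N * (m 1%N 1%N * m 2%N 2%N - m 1%N 2%N * m 2%N 1%N)
         - m 0%N 1%N * (m 1%N 0%N * m 2%N 2%N - m 1%N 2%N * m 2%N 0%N)
         + m 0%N 2%N * (m 1%N 0%N * m 2%N 1%N - m 1%N 1%N * m 2%N 0%N).
Proof.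
have E a b : M a b = m a b by rewrite /m !inord_val.
rewrite (expand_det_row _ ord0) !big_ord_recl big_ord0 /cofactor.
rewrite !(expand_det_row _ ord0) !big_ord_recl !big_ord0 /cofactor !det_mx11 !mxE !E /=.
rewrite /bump /=.
ring.
Qed.

(** Coordinates are numbered from 1 to 7, as in the indices of [e3]. *)
Definition entry u (k : nat) : R := u 0 (inord k.-1).

Definition minor3 (i j k : nat) u v w : R :=
  entry u i * (entry v j * entry w k - entry w j * entry v k)
  - entry v i * (entry u j * entry w k - entry w j * entry u k)
  + entry w i * (entry u j * entry v k - entry v j * entry u k).
Lemma e3E i j k u v w : e3 i j k u v w = minor3 i j k u v w.
Proof.
by rewrite /e3 det3 !mxE /= !inordK.
Qed.

(** The product determined by phi0 and the Euclidean metric: [cross u v]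
    represents the linear form phi0(u, v, -); see [dot_cross]. *)
Definition cross u v : 'rV[R]_7 := \row_k phi0 u v (delta_mx 0 k).

Lemma entryP u v : (forall k, (0 < k < 8)%N -> entry u k = entry v k) -> u = v.
Proof.
by move=> uv; apply/rowP => i; have := uv i.+1 (ltn_ord i); rewrite /entry /= inord_val.
Qed.

Lemma dot7 u v : dot u v = \sum_(1 <= k < 8) entry u k * entry v k.
Proof.
rewrite dotE big_add1 big_mkord; apply: eq_bigr => i _.
by rewrite /entry /= inord_val.
Qed.

Lemma entry_delta (i k : nat) : (0 < i < 8)%N -> (0 < k < 8)%N ->
  entry (delta_mx 0 (inord i.-1)) k = (i == k)%:R.
Proof.
move=> /andP[i0 i8] /andP[k0 k8]; rewrite /entry mxE /= eq_sym.
congr (nat_of_bool _)%:R; apply/eqP/eqP => [/(congr1 val)|->//].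
by rewrite /= !inordK ?prednK// => h; rewrite -(prednK i0) -(prednK k0) h.
Qed.

(** The coordinates of the cross product, with index 0 as a dummy; they are
    read off the seven monomials of phi0. *)
Definition cross_poly (x y : nat -> R) (k : nat) : R := nth 0 [:: 0;
   x 2%N * y 3%N - x 3%N * y 2%N - (x 4%N * y 5%N - x 5%N * y 4%N) - (x 6%N * y 7%N - x 7%N * y 6%N);
   x 3%N * y 1%N - x 1%N * y 3%N - (x 4%N * y 6%N - x 6%N * y 4%N) - (x 7%N * y 5%N - x 5%N * y 7%N);
   x 1%N * y 2%N - x 2%N * y 1%N - (x 4%N * y 7%N - x 7%N * y 4%N) - (x 5%N * y 6%N - x 6%N * y 5%N);
   x 1%N * y 5%N - x 5%N * y 1%N + (x 2%N * y 6%N - x 6%N * y 2%N) + (x 3%N * y 7%N - x 7%N * y 3%N);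
   x 4%N * y 1%N - x 1%N * y 4%N - (x 2%N * y 7%N - x 7%N * y 2%N) + (x 3%N * y 6%N - x 6%N * y 3%N);
   x 1%N * y 7%N - x 7%N * y 1%N - (x 2%N * y 4%N - x 4%N * y 2%N) - (x 3%N * y 5%N - x 5%N * y 3%N);
   x 6%N * y 1%N - x 1%N * y 6%N + (x 2%N * y 5%N - x 5%N * y 2%N) - (x 3%N * y 4%N - x 4%N * y 3%N)] k.

Lemma entry_cross u v k : (0 < k < 8)%N ->
  entry (cross u v) k = cross_poly (entry u) (entry v) k.
Proof.
move=> k8; rewrite {1}/entry mxE /phi0 !e3E /minor3.
rewrite !(@entry_delta k)//.
move: k k8 => [|[|[|[|[|[|[|[|k]]]]]]]] //= _; rewrite /cross_poly /=; ring.
Qed.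

Lemma dot_cross u v w : dot (cross u v) w = phi0 u v w.
Proof.
rewrite dot7 unlock /= !entry_cross// /phi0 !e3E /minor3 /cross_poly /=; ring.
Qed.

(** The identity on which everything else rests: for a unit vector u, the map
    [cross u] is a complex structure on the orthogonal of u. It is a polynomial
    identity in the 14 coordinates. *)
Lemma cross_cross u v : cross u (cross u v) = dot u v *: u - dot u u *: v.
Proof.
apply: entryP => k k8; rewrite entry_cross//.
have -> : entry (dot u v *: u - dot u u *: v) k = dot u v * entry u k - dot u u * entry v k.
  by rewrite /entry !mxE.
rewrite !dot7 unlock /=.
have E : forall j, (0 < j < 8)%N -> entry (cross u v) j = cross_poly (entry u) (entry v) j.
  by move=> j; exact: entry_cross.
move: k k8 => [|[|[|[|[|[|[|[|k]]]]]]]] //= _; rewrite /cross_poly/= !E// /cross_poly /=; ring.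
Qed.

End Cross.

Section G2Algebra.
Variable R : realType.
Implicit Types u v w x y a b : 'rV[R]_7.
Implicit Type A : 'M[R]_7.

Lemma entryD u v k : entry (u + v) k = entry u k + entry v k.
Proof. exact: mxE. Qed.

Lemma entryZ (c : R) u k : entry (c *: u) k = c * entry u k.
Proof. exact: mxE. Qed.

Lemma crossDl u v w : cross (u + v) w = cross u w + cross v w.
Proof.
apply: entryP => k k8; rewrite entryD !entry_cross//.
by move: k k8 => [|[|[|[|[|[|[|[|k]]]]]]]] //= _; rewrite /cross_poly /= !entryD; ring.
Qed.

Lemma crossZl c u w : cross (c *: u) w = c *: cross u w.
Proof.
apply: entryP => k k8; rewrite entryZ !entry_cross//.
by move: k k8 => [|[|[|[|[|[|[|[|k]]]]]]]] //= _; rewrite /cross_poly /= !entryZ; ring.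
Qed.

Lemma crossC u v : cross u v = - cross v u.
Proof.
apply: entryP => k k8; rewrite -scaleN1r entryZ !entry_cross//.
by move: k k8 => [|[|[|[|[|[|[|[|k]]]]]]]] //= _; rewrite /cross_poly /=; ring.
Qed.

Lemma crossDr u v w : cross u (v + w) = cross u v + cross u w.
Proof. by rewrite crossC crossDl opprD -!(crossC u). Qed.

Lemma crossZr c u w : cross u (c *: w) = c *: cross u w.
Proof. by rewrite crossC crossZl -scalerN (crossC w) opprK. Qed.

Lemma crossNr u v : cross u (- v) = - cross u v.
Proof. by rewrite -[- v]scaleN1r crossZr scaleN1r. Qed.

Lemma cross0r v : cross v 0 = 0.
Proof. by rewrite -[X in cross _ X](scale0r (0 : 'rV_7)) crossZr scale0r. Qed.

Lemma crossvv u : cross u u = 0.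
Proof.
have /eqP : cross u u + cross u u = 0 by rewrite {1}crossC addNr.
by rewrite -mulr2n -scaler_nat scaler_eq0 pnatr_eq0 => /eqP.
Qed.

Lemma dot_crossA u v w : dot (cross u v) w = dot u (cross v w).
Proof.
by rewrite !dot7 unlock /= !entry_cross// /cross_poly /=; ring.
Qed.

Lemma dot_crossl u v : dot (cross u v) u = 0.
Proof. by rewrite dotC -dot_crossA crossvv dot0l. Qed.

Lemma dot_crossr u v : dot (cross u v) v = 0.
Proof. by rewrite dot_crossA crossvv dot0r. Qed.

Lemma dot_cross_cross u v w :
  dot (cross u v) (cross u w) = dot u u * dot v w - dot u v * dot u w.
Proof.
rewrite crossC dotNl dot_crossA cross_cross dotDr dotNr !dotZr.
by rewrite (dotC v u); ring.
Qed.

Lemma cross_cross_polar u v w : cross u (cross v w) + cross v (cross u w) =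
  dot u w *: v + dot v w *: u - (2 * dot u v) *: w.
Proof.
have := cross_cross (u + v) w.
rewrite !crossDl !crossDr !cross_cross !dotDl !dotDr (dotC v u) => /eqP.
rewrite -subr_eq0 => /eqP h; apply/eqP; rewrite -subr_eq0; apply/eqP.
rewrite -[RHS]h; apply/rowP => i; rewrite !mxE; ring.
Qed.

Lemma cross_anticomm u v w : dot u v = 0 -> dot u w = 0 -> dot v w = 0 ->
  cross u (cross v w) = - cross v (cross u w).
Proof.
move=> uv uw vw; apply/eqP; rewrite -addr_eq0 cross_cross_polar uv uw vw.
by rewrite mulr0 !scale0r addr0 subr0.
Qed.

Lemma cross_eq0 u v : dot u v = 0 -> cross u v = 0 -> u != 0 -> v = 0.
Proof.
move=> uv c0 u0; have := cross_cross u v; rewrite c0 cross0r uv scale0r sub0r.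
by move/esym/eqP; rewrite oppr_eq0 scaler_eq0 dot_eq0 (negPf u0) => /eqP.
Qed.

Lemma cross_eq0_free u v : cross u v = 0 -> u != 0 -> exists c, v = c *: u.
Proof.
move=> c0 u0; have := cross_cross u v; rewrite c0 cross0r.
move/esym/eqP; rewrite subr_eq0 => /eqP h; exists ((dot u u)^-1 * dot u v).
by rewrite -scalerA h scalerA mulVf ?scale1r// dot_eq0.
Qed.

(** If a + ib is annihilated by the product with the complex vector x + iy,
    then x + iy is isotropic for the complexified metric unless a + ib is a
    multiple of it. This is the real part of that statement: applying [cross x]
    to the first equation, [cross y] to the second and adding leaves only terms
    in x, y, a and b. It characterizes orthogonal pairs of equal length by an
    equation in which only the cross product of pairs occurs, hence by phi0
    alone. *)
Lemma cross_pencil x y a b : cross x a = cross y b -> cross x b = - cross y a ->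
  (dot x x - dot y y) *: a - (2 * dot x y) *: b =
  (dot x a - dot y b) *: x - (dot y a + dot x b) *: y.
Proof.
move=> h1 h2; have := cross_cross_polar x y b.
rewrite -h1 h2 crossNr !cross_cross => /eqP.
rewrite -subr_eq0 => /eqP h; apply/eqP; rewrite -subr_eq0 -oppr_eq0; apply/eqP.
rewrite -[RHS]h; apply/rowP => i; rewrite !mxE; ring.
Qed.

Lemma exists_ortho (k n : nat) (M : 'M[R]_(k, n)) : (k < n)%N ->
  exists2 a : 'rV[R]_n, dot a a = 1 & forall i, dot (row i M) a = 0.
Proof.
move=> kn; have : kermx M^T != 0.
  rewrite -mxrank_eq0 -lt0n mxrank_ker subn_gt0 mxrank_tr.
  exact: leq_ltn_trans (rank_leq_row _) kn.
case/rowV0Pn => a /sub_kermxP aM a0.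
have [c ca1] := exists_unit a0; exists (c *: a) => // i.
rewrite dotZr dotC /dot tr_row colE mulmxA aM mul0mx mxE mulr0//.
Qed.

Lemma exists_ortho4 u v w x : exists2 a, dot a a = 1 &
  [/\ dot u a = 0, dot v a = 0, dot w a = 0 & dot x a = 0].
Proof.
pose M := \matrix_(i < 4) nth u [:: u; v; w; x] i.
have [a a1 aM] := @exists_ortho 4 7 M isT; exists a => //.
by split; [have := aM 0|have := aM 1|have := aM (inord 2)|have := aM (inord 3)];
  rewrite rowK ?inordK.
Qed.

(** * Linear maps preserving phi0 are isometries *)

(** This is the group G2: invertibility is a consequence, see [G2_unit]. *)
Definition in_G2 A := forall u v w, phi0 (u *m A) (v *m A) (w *m A) = phi0 u v w.

Section Metric.
Variable A : 'M[R]_7.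
Hypothesis GA : in_G2 A.

Lemma G2_dot_cross u v w :
  dot (cross (u *m A) (v *m A)) (w *m A) = dot (cross u v) w.
Proof. by rewrite !dot_cross GA. Qed.

(** The form phi0(u, -, -) vanishes only for u = 0. *)
Lemma G2_inj u : u *m A = 0 -> u = 0.
Proof.
move=> uA; apply/eqP/negP => /negP u0.
have [a a1 [ua _ _ _]] := exists_ortho4 u u u u.
have : cross u a = 0.
  by apply: dot_inj => w; rewrite -G2_dot_cross uA crossC cross0r oppr0 !dot0l.
move/cross_eq0 => /(_ ua u0) /eqP; rewrite -dot_eq0 a1; apply/negP.
exact: oner_neq0.
Qed.

Lemma G2_unit : A \in unitmx.
Proof.
rewrite -row_free_unit -kermx_eq0; apply/eqP/row_matrixP => i.
by rewrite row0; apply: G2_inj; apply/sub_kermxP/row_sub.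
Qed.

(** An equality between cross products is an equality between linear forms
    phi0(u, v, -), so it is transported by a map preserving phi0 before that
    map is known to be an isometry. *)
Lemma G2_cross_eq u v x y : cross u v = cross x y ->
  cross (u *m A) (v *m A) = cross (x *m A) (y *m A).
Proof.
move=> uv; apply: dot_inj => w.
by rewrite -(mulmxKV G2_unit w) !G2_dot_cross uv.
Qed.

(** A map preserving phi0 preserves the pairs x, y for which there are vectors
    a, b, independent of x and y, with [cross x a = cross y b] and [cross x b =
    - cross y a]. An orthonormal pair admits such a and b: take a orthogonal to
    x, y and [cross x y], and solve the first equation for b. By [cross_pencil]
    the images of x and y are then orthogonal and of the same length. *)
Lemma G2_conformal x y : dot x x = 1 -> dot y y = 1 -> dot x y = 0 ->
  dot (x *m A) (x *m A) = dot (y *m A) (y *m A) /\ dot (x *m A) (y *m A) = 0.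
Proof.
move=> x1 y1 xy.
have [a a1 [xa ya xya _]] := exists_ortho4 x y (cross x y) x.
(* The map [cross y] squares to -1 on the orthogonal of y, so this b solves the
   first equation. *)
pose b := - cross y (cross x a).
have yxa : dot y (cross x a) = 0 by rewrite -dot_crossA crossC dotNl xya oppr0.
have h1 : cross x a = cross y b.
  by rewrite /b crossNr cross_cross yxa scale0r sub0r opprK y1 scale1r.
have h2 : cross x b = cross y (- a).
  rewrite /b !crossNr (@cross_anticomm x y)//; last by rewrite dotC dot_crossl.
  by rewrite opprK cross_cross xa x1 scale0r sub0r scale1r crossNr.
have xb : dot x b = 0.
  by rewrite /b dotNr -dot_crossA dot_cross_cross ya xy mul0r mulr0 subrr oppr0.
have yb : dot y b = 0 by rewrite dotNr -dot_crossA crossvv dot0l oppr0.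
have ba : dot b a = 0.
  rewrite dotNl crossC dotNl opprK dot_crossA (crossC x) (crossC y) dotNl dotNr.
  by rewrite dot_cross_cross xy (dotC a x) xa mulr0 mul0r subrr !oppr0.
have /(cross_pencil (G2_cross_eq h1)) : cross (x *m A) (b *m A) = - cross (y *m A) (a *m A).
  by rewrite (G2_cross_eq h2) mulNmx crossNr.
set p := dot (x *m A) (x *m A) - _; set q := dot (x *m A) (y *m A); set r := dot _ (a *m A) - _; set s := dot _ (a *m A) + _ => h.
have : p *: a - (2 * q) *: b - (r *: x - s *: y) = 0.
  by apply: G2_inj; rewrite !mulmxBl -!scalemxAl h subrr.
have D t : dot (p *: a - (2 * q) *: b - (r *: x - s *: y)) t = p * dot a t - 2 * q * dot b t - (r * dot x t - s * dot y t).
  by rewrite !(dotDl, dotNl, dotZl).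
move=> e0; have := D a; rewrite e0 dot0l a1 ba xa ya !mulr0 mulr1 !subr0.
move=> /esym p0; split; first exact: subr0_eq p0.
have := D b; rewrite e0 dot0l p0 xb yb !mulr0 mul0r !subr0 sub0r.
rewrite (_ : dot b b = 1) ?mulr1; last first.
  rewrite /b dotNl dotNr opprK dot_cross_cross y1 mul1r yxa mulr0 subr0.
  by rewrite dot_cross_cross x1 a1 xa mulr0 subr0 mulr1.
by move=> /eqP; rewrite eq_sym oppr_eq0 mulf_eq0 pnatr_eq0 /= => /eqP.
Qed.

(** By [G2_conformal] the map multiplies the metric by a factor l. Comparing
    the lengths of the two sides of [l *: cross (u *m A) (v *m A) = cross u v
    *m A] for orthonormal u and v gives l^4 = l, so l = 1. *)
Lemma G2_ortho : A *m A^T = 1%:M.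
Proof.
pose l := dot (delta_mx 0 0 *m A) (delta_mx 0 0 *m A).
have e1 i : dot (delta_mx 0 i : 'rV[R]_7) (delta_mx 0 i) = 1.
  by rewrite dot_delta mxE !eqxx.
have e0 i j : i != j -> dot (delta_mx 0 i : 'rV[R]_7) (delta_mx 0 j) = 0.
  by move=> /negPf ij; rewrite dot_delta mxE eq_sym ij andbF.
have AE i j : (A *m A^T) i j = dot (delta_mx 0 i *m A) (delta_mx 0 j *m A).
  rewrite /dot trmx_mul mulmxA -(mulmxA _ A) trmx_delta -rowE -colE !mxE //.
have Al : A *m A^T = l%:M.
  apply/matrixP => i j; rewrite AE mxE; have [<-|ij] := eqVneq i j.
    have [->//|i0] := eqVneq i 0.
    by have [] := G2_conformal (e1 i) (e1 0) (e0 _ _ i0).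
  by rewrite (proj2 (G2_conformal (e1 i) (e1 j) (e0 _ _ ij))).
have dA u v : dot (u *m A) (v *m A) = l * dot u v.
  by rewrite /dot trmx_mul mulmxA -(mulmxA u) Al mul_mx_scalar -scalemxAl mxE.
have cA u v : l *: cross (u *m A) (v *m A) = cross u v *m A.
  have := mulmxKV G2_unit (cross (u *m A) (v *m A)); set z := _ *m invmx A => zA.
  rewrite -zA scalemxAl; congr (_ *m A); apply: dot_inj => w.
  by rewrite -G2_dot_cross -zA dA dotZl.
pose e i : 'rV[R]_7 := delta_mx 0 i.
have l0 : 0 < l.
  rewrite lt_def dot_ge0 andbT dot_eq0; apply/eqP => /G2_inj /(congr1 (fun x => dot x (e 0))).
  by rewrite e1 dot0l; apply/eqP; exact: oner_neq0.
have := congr1 (fun x => dot x x) (cA (e 0) (e 1)).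
rewrite dotZl dotZr dA !dot_cross_cross !dA !e1 e0// => h.
have l3 : l ^+ 3 = 1.
  have ln0 : l != 0 by rewrite gt_eqF.
  apply: (mulfI ln0); move: h; rewrite !(mulr0, mul0r, mulr1, subr0) => h; rewrite -[RHS]h; ring.
suff l1 : l = 1 by rewrite Al l1.
have : (l - 1) * (l ^+ 2 + l + 1) = 0 by rewrite -[RHS](subrr (l ^+ 3)) {2}l3; ring.
move/eqP; rewrite mulf_eq0 subr_eq0 => /orP[/eqP//|].
by rewrite gt_eqF// !addr_gt0// exprn_gt0.
Qed.

Lemma G2_dot u v : dot (u *m A) (v *m A) = dot u v.
Proof. by rewrite /dot trmx_mul mulmxA -(mulmxA u) G2_ortho mulmx1. Qed.

Lemma G2_cross u v : cross (u *m A) (v *m A) = cross u v *m A.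
Proof.
by apply: dot_inj => w; rewrite -(mulmxKV G2_unit w) G2_dot_cross G2_dot.
Qed.

End Metric.
End G2Algebra.

(** * Rigidity of a map fixing a G2 triple *)

Section Triple.
Variable R : realType.
Implicit Types u v w x y z : 'rV[R]_7.
Implicit Type A : 'M[R]_7.

(** Orthonormal u, v, w with w also orthogonal to [cross u v]; such a triple
    generates R^7 under the cross product. *)
Definition G2_triple u v w :=
  [/\ [/\ dot u u = 1, dot v v = 1 & dot w w = 1],
      [/\ dot u v = 0, dot u w = 0 & dot v w = 0] & dot (cross u v) w = 0].

Definition triple_frame u v w : 'M[R]_7 := \matrix_(i < 7)
  nth 0 [:: u; v; cross u v; w; cross w u; cross w v; cross w (cross u v)] i.

(** The seven products of a G2 triple are orthonormal: the span of u, v and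
    [cross u v] is closed under the product, and [cross w] maps it
    isometrically into the orthogonal of itself and w. *)
Lemma triple_frame_ortho u v w : G2_triple u v w ->
  triple_frame u v w *m (triple_frame u v w)^T = 1%:M.
Proof.
move=> [[uu vv ww] [uv uw vw] tw].
set t := cross u v in tw *.
have ut : cross u t = - v by rewrite cross_cross uv uu scale0r sub0r scale1r.
have vt : cross v t = u.
  by rewrite /t (crossC u) crossNr cross_cross dotC uv vv scale0r sub0r opprK scale1r.
have ht : dot t t = 1 by rewrite dot_cross_cross uu vv uv mulr0 subr0 mulr1.
have ut0 : dot u t = 0 by rewrite dotC dot_crossl.
have vt0 : dot v t = 0 by rewrite dotC dot_crossr.
have wt : dot w t = 0 by rewrite dotC.
have wu : dot w u = 0 by rewrite dotC.
have wv : dot w v = 0 by rewrite dotC.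
have C x y : dot w x = 0 -> dot w y = 0 -> dot (cross w x) (cross w y) = dot x y.
  by move=> wx wy; rewrite dot_cross_cross ww wx mul0r subr0 mul1r.
have D x y : dot x (cross w y) = dot w (cross y x) by rewrite dotC dot_crossA.
have Wl y : dot w (cross w y) = 0 by rewrite dotC dot_crossl.
have vu' : cross v u = - t by rewrite crossC.
have tu : cross t u = v by rewrite crossC ut opprK.
have tv : cross t v = - u by rewrite crossC vt.
have DE := (uu, vv, ww, ht, uv, uw, vw, tw, ut0, vt0, wt, wu, wv, dotC v u, dotC t u, dotC t v).
(* The 49 inner products are evaluated with the identities C, D and Wl for
   products with w, and the multiplication table of u, v, t. *)
apply/matrixP => i j; rewrite mxE.
transitivity (dot (row i (triple_frame u v w)) (row j (triple_frame u v w))).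
  by rewrite dotE; apply: eq_bigr => k _; rewrite !mxE.
rewrite !rowK; case: i j => [i i7] [j j7]; rewrite [in RHS]mxE -val_eqE /=.
rewrite -/t; move: i7 j7.
case: i => [|[|[|[|[|[|[|i]]]]]]] //; case: j => [|[|[|[|[|[|[|j]]]]]]] // _ _ /=;
  first [by rewrite ?C ?DE | by rewrite Wl | by rewrite dot_crossl
  | by rewrite D ?(crossvv, ut, vt, vu', tu, tv) ?dotNr ?dot0r ?DE ?oppr0
  | by rewrite dotC D ?(crossvv, ut, vt, vu', tu, tv) ?dotNr ?dot0r ?DE ?oppr0].
Qed.

(** A map preserving phi0 preserves the metric and hence the cross product, so
    it fixes the whole frame generated by the triple. *)
Lemma G2_triple_rigid A u v w : in_G2 A -> G2_triple u v w ->
  u *m A = u -> v *m A = v -> w *m A = w -> A = 1%:M.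
Proof.
move=> GA uvw uA vA wA; have := triple_frame_ortho uvw.
set M := triple_frame u v w => MM; have [Mu _] := mulmx1_unit MM.
have MA : M *m A = M.
  apply/row_matrixP => i; rewrite row_mul rowK.
  case: i => [[|[|[|[|[|[|[|i]]]]]]] //= _];
  by rewrite -?(G2_cross GA) ?uA ?vA ?wA.
by rewrite -[A]mul1mx -(mulVmx Mu) -mulmxA MA.
Qed.

End Triple.

(** * Minimal stable subspaces of commuting matrices *)

Section Commuting.
Variables (R : realType) (n : nat).
Implicit Types (g h W K : 'M[R]_n) (x : 'rV[R]_n) (T : set 'M[R]_n).

(** A complex eigenvalue a + ib of G has an eigenvector x + iy; both x and y
    are annihilated by (G - a)^2 + b^2, and one of them is nonzero. *)
Lemma real_eigen_quadratic (r : nat) (G : 'M[R]_r) : (0 < r)%N ->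
  exists a b (y : 'rV[R]_r), y != 0 /\
    y *m (G - a%:M) *m (G - a%:M) = - (b ^+ 2) *: y.
Proof.
move=> r0; pose C : numClosedFieldType := R[i].
pose Gc : 'M[C]_r := map_mx (real_complex R) G.
have /closed_rootP[mu] : size (char_poly Gc) != 1.
  by rewrite size_char_poly eqSS -lt0n.
rewrite -eigenvalue_root_char => /eigenvalueP[z zG z0].
pose a := complex.Re mu; pose b := complex.Im mu.
pose x : 'rV[R]_r := map_mx (@complex.Re R) z.
pose y : 'rV[R]_r := map_mx (@complex.Im R) z.
have ReM (c d : C) : complex.Re (c * d) = complex.Re c * complex.Re d - complex.Im c * complex.Im d.
  by case: c d => [c1 c2] [d1 d2].
have ImM (c d : C) : complex.Im (c * d) = complex.Re c * complex.Im d + complex.Im c * complex.Re d.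
  by case: c d => [c1 c2] [d1 d2].
have xG : x *m G = a *: x - b *: y.
  apply/rowP => j; have := congr1 (fun M : 'rV_r => complex.Re (M 0 j)) zG.
  rewrite !mxE raddf_sum /= ReM => <-; apply: eq_bigr => i _.
  by rewrite ReM !mxE mulr0 subr0.
have yG : y *m G = b *: x + a *: y.
  apply/rowP => j; have := congr1 (fun M : 'rV_r => complex.Im (M 0 j)) zG.
  rewrite !mxE raddf_sum /= ImM addrC => <-; apply: eq_bigr => i _.
  by rewrite ImM !mxE mulr0 add0r.
have xa : x *m (G - a%:M) = - b *: y.
  by rewrite mulmxBr xG mul_mx_scalar addrAC subrr sub0r scaleNr.
have ya : y *m (G - a%:M) = b *: x.
  by rewrite mulmxBr yG mul_mx_scalar addrK.
exists a, b; have [x0|x0] := eqVneq x 0; last first.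
  exists x; split=> //; by rewrite xa -scalemxAl ya scalerA mulNr expr2.
exists y; split; last by rewrite ya -scalemxAl xa scalerA mulrN expr2.
apply: contra z0 => /eqP y0; apply/eqP/rowP => i; rewrite mxE.
have := congr1 (fun M : 'rV_r => M 0 i) x0; have := congr1 (fun M : 'rV_r => M 0 i) y0.
by rewrite !mxE; case: (z 0 i) => [z1 z2] /= -> ->.
Qed.

Definition stable_by T W := forall g, T g -> stablemx W g.

Definition minimal_stable T W := [/\ W != 0, stable_by T W &
  forall W', (W' <= W)%MS -> W' != 0 -> stable_by T W' -> (W <= W')%MS].

Lemma exists_minimal_stable T W : W != 0 -> stable_by T W ->
  exists2 W', (W' <= W)%MS & minimal_stable T W'.
Proof.
have [k] := ubnP (\rank W); elim: k W => // k IH W Wk W0 TW.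
have [[W' [W'W W'0 TW' nWW']]|noW'] := pselect (exists W',
    [/\ (W' <= W)%MS, W' != 0, stable_by T W' & ~~ (W <= W')%MS]).
  have [|W'' W''W' mW''] := IH W' _ W'0 TW'.
    apply: (@leq_trans (\rank W)) => //.
    by apply: (rank_ltmx (A := W')); rewrite /ltmx W'W.
  by exists W'' => //; apply: submx_trans W''W' W'W.
exists W => //; split=> // W' W'W W'0 TW'.
by apply/negPn/negP => h; apply: noW'; exists W'.
Qed.

Lemma stable_rV W g : (forall x, (x <= W)%MS -> (x *m g <= W)%MS) -> stablemx W g.
Proof.
move=> h; apply/row_subP => i; rewrite row_mul.
by apply: h; exact: row_sub.
Qed.

(** Schur's lemma: the kernel of K in W is stable under T, so it is W as soon
    as it is nonzero. *)
Lemma minimal_stable_kernel T W K x : minimal_stable T W ->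
  (forall g, T g -> g *m K = K *m g) ->
  (x <= W)%MS -> x != 0 -> x *m K = 0 -> W *m K = 0.
Proof.
move=> [W0 TW mW] TK xW x0 xK; apply/eqP; rewrite -sub_kermx.
have xI : (x <= W :&: kermx K)%MS by rewrite sub_capmx xW; apply/sub_kermxP.
apply: submx_trans (capmxSr W (kermx K)); apply: mW; first exact: capmxSl.
  by apply: contraNneq x0 => I0; rewrite I0 submx0 in xI.
move=> g Tg; apply: stable_rV => y; rewrite !sub_capmx => /andP[yW /sub_kermxP yK].
rewrite (submx_trans (submxMr _ yW) (TW _ Tg)); apply/sub_kermxP.
by rewrite -mulmxA TK// mulmxA yK mul0mx.
Qed.

(** On a minimal subspace the quadratic relation provided by one eigenvector
    holds everywhere. *)
Lemma minimal_stable_quadratic T W g : minimal_stable T W ->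
  (forall h, T h -> h *m g = g *m h) -> T g ->
  exists a b, W *m (g - a%:M) *m (g - a%:M) = - (b ^+ 2) *: W.
Proof.
move=> mW TC Tg; have [W0 TW _] := mW; pose B := row_base W.
have r0 : (0 < \rank W)%N by rewrite lt0n mxrank_eq0.
pose G := B *m g *m pinvmx B.
have GB : G *m B = B *m g.
  by rewrite mulmxKpV// (eqmxMr g (eq_row_base W)) eq_row_base; exact: TW.
have [a [b [y [y0 yG]]]] := real_eigen_quadratic G r0.
pose K := (g - a%:M) *m (g - a%:M) + (b ^+ 2)%:M.
have TK h : T h -> h *m K = K *m h.
  move=> Th; rewrite mulmxDr [RHS]mulmxDl (scalar_mxC _ h); congr (_ + _).
  have gh : h *m (g - a%:M) = (g - a%:M) *m h.
    by rewrite mulmxBr mulmxBl TC// scalar_mxC.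
  by rewrite mulmxA gh -mulmxA gh mulmxA.
suff : W *m K = 0.
  rewrite mulmxDr mul_mx_scalar mulmxA => /eqP; rewrite addr_eq0 => /eqP WK.
  by exists a, b; rewrite WK scaleNr.
apply: (minimal_stable_kernel mW TK (x := y *m B)).
- by rewrite (submx_trans (submxMl _ _))// eq_row_base.
- apply: contra y0 => /eqP yB; apply/eqP/(row_free_inj (row_base_free W)).
  by rewrite yB mul0mx.
have E z : z *m B *m (g - a%:M) = z *m (G - a%:M) *m B.
  by rewrite !mulmxBr !mulmxBl -(mulmxA z B g) -GB !mul_mx_scalar -scalemxAl mulmxA.
by rewrite mulmxDr mul_mx_scalar mulmxA !E yG -scalemxAl scaleNr addNr.
Qed.

(** If J is a complex structure commuting with the family, then every member
    acts on a minimal subspace as a complex scalar: (g - a)^2 + b^2 factors as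
    (g - a - bJ)(g - a + bJ), and one of the factors has a kernel. *)
Lemma minimal_stable_complex T W g J : minimal_stable T W ->
  (forall h k, T h -> T k -> h *m k = k *m h) -> T g -> T J ->
  W *m J *m J = - W -> exists a b, W *m g = a *: W + b *: (W *m J).
Proof.
move=> mW TC Tg TJ WJJ.
have [a [b Wgg]] := minimal_stable_quadratic mW (fun h Th => TC h g Th Tg) Tg.
have [/rowV0Pn[x xW x0] _ _] := mW.
have xg : x *m (g - a%:M) *m (g - a%:M) = - (b ^+ 2) *: x.
  have /submxP[D ->] := xW.
  by rewrite -mulmxA -mulmxA (mulmxA W) Wgg -scalemxAr.
pose K c : 'M[R]_n := g - a%:M + c *: J.
have TK c h : T h -> h *m K c = K c *m h.
  move=> Th; rewrite mulmxDr mulmxBr mulmxDl mulmxBl -scalemxAr -scalemxAl.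
  by rewrite (TC h g)// (TC h J)// scalar_mxC.
have KW c : W *m K c = 0 -> W *m g = a *: W + (- c) *: (W *m J).
  rewrite mulmxDr mulmxBr mul_mx_scalar -scalemxAr => /eqP.
  by rewrite addr_eq0 subr_eq scaleNr addrC => /eqP.
have xJJ : x *m J *m J = - x.
  by have /submxP[D ->] := xW; rewrite -!mulmxA (mulmxA W) WJJ mulmxN.
have xKK : x *m K b *m K (- b) = 0.
  rewrite /K; move: xg; set P := g - a%:M => xg.
  have PJ : P *m J = J *m P.
    by rewrite mulmxBl mulmxBr (TC g J)// scalar_mxC.
  move: P xg PJ => P xg PJ.
  rewrite !mulmxDr !mulmxDl xg -!scalemxAr -!scalemxAl -!mulmxA PJ.
  rewrite (mulmxA x J J) xJJ scalerA; apply/rowP => i; rewrite !mxE; ring.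
have [xK|xK] := eqVneq (x *m K b) 0.
  by exists a, (- b); apply: KW; exact: minimal_stable_kernel (TK b) xW x0 xK.
exists a, (- - b); apply: KW; apply: minimal_stable_kernel (TK (- b)) _ xK xKK => //.
have [_ TW _] := mW.
have Wst h : T h -> (x *m h <= W)%MS.
  by move=> Th; rewrite (submx_trans (submxMr _ xW))//; exact: TW.
rewrite /K mulmxDr mulmxBr mul_mx_scalar -scalemxAr.
by rewrite !addmx_sub ?eqmx_opp ?scalemx_sub ?Wst.
Qed.

End Commuting.

(** * Frames adapted to an abelian group preserving phi0 *)

Section Frames.
Variable R : realType.
Implicit Types u v w x y z : 'rV[R]_7.
Implicit Types (g h J W A : 'M[R]_7) (S : set 'M[R]_7).

(** The rows of M are the vectors to which the space is orthogonal. *)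
Definition ortho_space (k : nat) (M : 'M[R]_(k, 7)) : 'M[R]_7 := kermx M^T.

Lemma ortho_spaceP k (M : 'M[R]_(k, 7)) x :
  reflect (forall i, dot (row i M) x = 0) (x <= ortho_space M)%MS.
Proof.
have E i : dot (row i M) x = (x *m M^T) 0 i.
  rewrite dotC dotE mxE; apply: eq_bigr => j _; by rewrite !mxE.
apply: (iffP sub_kermxP) => h; first by move=> i; rewrite E h mxE.
by apply/rowP => i; rewrite -E h mxE.
Qed.

Lemma ortho_space_neq0 k (M : 'M[R]_(k, 7)) : (k < 7)%N -> ortho_space M != 0.
Proof.
move=> k7; have [a a1 /ortho_spaceP aM] := exists_ortho M k7.
apply: contraTneq aM => ->; rewrite submx0 -dot_eq0 a1; exact: oner_neq0.
Qed.

Lemma ortho_space3P q1 q2 q3 x :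
  (x <= ortho_space (\matrix_(i < 3) nth 0 [:: q1; q2; q3] i))%MS <->
  [/\ dot q1 x = 0, dot q2 x = 0 & dot q3 x = 0].
Proof.
split=> [/ortho_spaceP h|[h1 h2 h3]].
  split; [have := h 0|have := h (inord 1)|have := h (inord 2)];
  by rewrite rowK ?inordK.
by apply/ortho_spaceP => i; rewrite rowK; case: i => [[|[|[|]]]].
Qed.

Definition cross_mx u : 'M[R]_7 := \matrix_i cross u (delta_mx 0 i).

Lemma mul_cross_mx u x : x *m cross_mx u = cross u x.
Proof.
rewrite mulmx_sum_row [in RHS](row_sum_delta x).
rewrite (big_morph (cross u) (crossDr u) (cross0r u)).
by apply: eq_bigr => i _; rewrite rowK crossZr.
Qed.

(** Here w is an eigenvector of every g for the complex structure [cross u] on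
    the orthogonal of u: g acts on the complex line of w by a + ib. *)
Definition G2_eigenvector S u w :=
  forall g, S g -> exists a b : R, w *m g = a *: w + b *: cross u w.

Section Fix.
Variables (S : set 'M[R]_7).
Hypothesis SG : forall g, S g -> in_G2 g.
Hypothesis SC : forall g h, S g -> S h -> g *m h = h *m g.

Section Fixu.
Variable u : 'rV[R]_7.
Hypotheses (u1 : dot u u = 1) (Su : forall g, S g -> u *m g = u).

(** A map preserving phi0 and fixing u is complex linear for [cross u]. *)
Lemma G2_fix_cross_mx g : S g -> g *m cross_mx u = cross_mx u *m g.
Proof.
move=> Sg; apply/row_matrixP => i; rewrite !rowE !mulmxA !mul_cross_mx.
by rewrite -(G2_cross (SG Sg)) Su.
Qed.

(** [minimal_stable_complex] applied to the family enlarged by the complex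
    structure [cross u]; any unit vector of a minimal subspace is a common
    eigenvector. *)
Lemma G2_exists_eigenvector W : W != 0 ->
  (forall x, (x <= W)%MS -> dot u x = 0) ->
  (forall x, (x <= W)%MS -> (cross u x <= W)%MS) ->
  (forall g x, S g -> (x <= W)%MS -> (x *m g <= W)%MS) ->
  exists w, [/\ (w <= W)%MS, dot w w = 1 & G2_eigenvector S u w].
Proof.
move=> W0 uW JW SW; pose J := cross_mx u; pose T := S `|` [set J].
have TC g h : T g -> T h -> g *m h = h *m g.
  move=> [Sg|->] [Sh|->//]; first exact: SC.
    by rewrite G2_fix_cross_mx.
  by rewrite G2_fix_cross_mx.
have TW : stable_by T W.
  move=> g [Sg|->]; apply: stable_rV => x xW; first exact: SW.
  by rewrite mul_cross_mx JW.
have [W' W'W mW'] := exists_minimal_stable W0 TW.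
have WJ : W' *m J *m J = - W'.
  apply/row_matrixP => i; rewrite !row_mul !mul_cross_mx cross_cross u1 scale1r.
  by rewrite uW ?(submx_trans (row_sub _ _))// scale0r sub0r raddfN.
have [/rowV0Pn[v vW' v0] _ _] := mW'.
have [c cv1] := exists_unit v0; exists (c *: v); split=> //.
  by rewrite scalemx_sub// (submx_trans vW').
move=> g Sg.
have Tg : T g by left.
have TJ : T J by right.
have [a [b Wg]] := minimal_stable_complex mW' TC Tg TJ WJ.
exists a, b; have /submxP[D vD] := vW'.
rewrite -mul_cross_mx vD -!scalemxAl -!mulmxA Wg mulmxDr -!scalemxAr.
by rewrite -/J scalerDr !scalerA ![c * _]mulrC.
Qed.

(** The orthogonal of u, v and [cross u v] is stable under [cross u], and under
    the family since the latter preserves the plane of v and [cross u v]; so it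
    contains a common eigenvector. *)
Lemma G2_frame_extend v : dot v v = 1 -> dot u v = 0 -> G2_eigenvector S u v ->
  exists2 w, G2_triple u v w & G2_eigenvector S u w.
Proof.
move=> v1 uv Sv.
have := @G2_exists_eigenvector (ortho_space (\matrix_(i < 3) nth 0 [:: u; v; cross u v] i)).
case.
- exact: ortho_space_neq0.
- by move=> x /ortho_space3P[].
- move=> x /ortho_space3P[ux vx tx]; apply/ortho_space3P; split.
  + by rewrite -dot_crossA crossvv dot0l.
  + by rewrite -dot_crossA crossC dotNl tx oppr0.
  + by rewrite dot_cross_cross vx ux !mulr0 subrr.
- move=> g x Sg /ortho_space3P[ux vx tx]; apply/ortho_space3P.
  have Dg y : dot y x = 0 -> dot (y *m g) (x *m g) = 0 by rewrite (G2_dot (SG Sg)).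
  have ug : dot u (x *m g) = 0 by have := Dg _ ux; rewrite Su.
  have [a [b vg]] := Sv g Sg.
  have := Dg _ vx; have := Dg _ tx; rewrite -(G2_cross (SG Sg)) Su// vg.
  rewrite crossDr !crossZr cross_cross uv u1 scale0r sub0r scale1r.
  rewrite !dotDl !dotZl !dotNl; set p := dot v _; set q := dot (cross _ _) _ => h1 h2.
  (* The relations h1 and h2 say that a - ib kills the complex number with
     parts p and q; it has modulus one. *)
  have ab : a ^+ 2 + b ^+ 2 = 1.
    have := G2_dot (SG Sg) v v; rewrite v1 vg !dotDl !dotDr !dotZl !dotZr v1.
    rewrite dot_cross_cross u1 v1 uv (dotC v) dot_crossr !mulr0 !mulr1 !subr0 => <-.
    ring.
  split=> //.
    rewrite -[p]mul1r -ab -[RHS](mulr0 (a - b)).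
    have -> : (a ^+ 2 + b ^+ 2) * p = a * (a * p + b * q) - b * (a * q + b * - p) by ring.
    by rewrite h1 h2 !mulr0 subrr.
  rewrite -[q]mul1r -ab.
  have -> : (a ^+ 2 + b ^+ 2) * q = b * (a * p + b * q) + a * (a * q + b * - p) by ring.
  by rewrite h1 h2 !mulr0 addr0.
by move=> w [/ortho_space3P[uw vw tw] w1 Sw]; exists w => //; split.
Qed.

Lemma G2_frame_exists :
  exists v w, [/\ G2_triple u v w, G2_eigenvector S u v & G2_eigenvector S u w].
Proof.
have := @G2_exists_eigenvector (ortho_space u); case.
- exact: ortho_space_neq0.
- by move=> x /ortho_spaceP/(_ 0); rewrite row_id.
- move=> x /ortho_spaceP/(_ 0); rewrite row_id => ux.
  by apply/ortho_spaceP => i; rewrite ord1 row_id -dot_crossA crossvv dot0l.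
- move=> g x Sg /ortho_spaceP/(_ 0); rewrite row_id => ux.
  apply/ortho_spaceP => i; rewrite ord1 row_id.
  by rewrite -(Su Sg) (G2_dot (SG Sg)).
move=> v [/ortho_spaceP/(_ 0)]; rewrite row_id => uv v1 Sv.
by have [w uvw Sw] := G2_frame_extend v1 uv Sv; exists v, w.
Qed.

End Fixu.

(** A commuting family closed under square roots, for instance the image of a
    torus, has a common fixed vector. Let W be minimal stable. If all members
    act on W by real scalars, these are 1 or -1, and 1 because each is a
    square. Otherwise some member yields a complex structure J on W, all
    members act on W by complex scalars a + bJ, and the product of w and wJ is
    multiplied by a^2 + b^2, which is 1 because lengths are preserved. *)
Lemma G2_exists_fixed : (forall g, S g -> exists2 h, S h & h *m h = g) ->
  exists2 u, dot u u = 1 & forall g, S g -> u *m g = u.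
Proof.
move=> Ssqrt.
have I0 : (1%:M : 'M[R]_7) != 0 by exact: oner_neq0.
have SI : stable_by S 1%:M by move=> g _; exact: submx1.
have [W _ mW] := exists_minimal_stable I0 SI.
suff [u u0 Su] : exists2 u : 'rV[R]_7, u != 0 & forall g, S g -> u *m g = u.
  have [c cu1] := exists_unit u0; exists (c *: u) => // g Sg.
  by rewrite -scalemxAl Su.
have [/rowV0Pn[w wW w0] TW _] := mW.
have SCr g (Sg : S g) h (Sh : S h) : h *m g = g *m h by exact: SC.
have [[g0 [a0 [b0 [Sg0 b00 Wg0]]]]|nb] := pselect (exists g a b, [/\ S g, b != 0 &
   W *m (g - a%:M) *m (g - a%:M) = - (b ^+ 2) *: W]).
  pose J := b0^-1 *: (g0 - a0%:M).
  have WJJ : W *m J *m J = - W.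
    rewrite -!scalemxAr -!scalemxAl Wg0 !scalerA.
    by rewrite (_ : _ * _ = -1) ?scaleN1r//; field.
  have SJ g : S g -> g *m J = J *m g.
    move=> Sg; rewrite -scalemxAr -scalemxAl mulmxBr mulmxBl.
    by rewrite scalar_mxC (SC Sg Sg0).
  pose T := S `|` [set J].
  have TC g h : T g -> T h -> g *m h = h *m g.
    by move=> [Sg|->] [Sh|->//]; [exact: SC|exact: SJ|rewrite SJ].
  have mWT : minimal_stable T W.
    have [W0 _ mW0] := mW; split=> //.
      move=> g [Sg|->]; first exact: TW.
      rewrite -scalemxAr scalemx_sub// mulmxBr mul_mx_scalar.
      by rewrite addmx_sub ?eqmx_opp ?scalemx_sub ?TW.
    by move=> W' W'W W'0 TW'; apply: mW0 => // g Sg; apply: TW'; left.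
  have wJJ : w *m J *m J = - w.
    by have /submxP[D ->] := wW; rewrite -!mulmxA (mulmxA W) WJJ mulmxN.
  have u0 : cross w (w *m J) != 0.
    apply/negP => /eqP /cross_eq0_free/(_ w0)[c wJ].
    have : (c ^+ 2 + 1) *: w = 0.
      by rewrite scalerDl scale1r expr2 -scalerA -wJ -[X in _ + X]opprK -wJJ {2}wJ -scalemxAl subrr.
    move/eqP; rewrite scaler_eq0 (negPf w0) orbF gt_eqF//.
    by rewrite ltr_wpDl// sqr_ge0.
  exists (cross w (w *m J)) => // g Sg.
  have Tg : T g by left.
  have TJ : T J by right.
  have [a [b Wg]] := minimal_stable_complex mWT TC Tg TJ WJJ.
  have wg : w *m g = a *: w + b *: (w *m J).
    have /submxP[D ->] := wW.
    by rewrite -mulmxA Wg mulmxDr -!scalemxAr !mulmxA.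
  have wJg : w *m J *m g = a *: (w *m J) - b *: w.
    by rewrite -mulmxA -SJ// mulmxA wg mulmxDl -!scalemxAl wJJ scalerN.
  have ug : cross w (w *m J) *m g = (a ^+ 2 + b ^+ 2) *: cross w (w *m J).
    rewrite -(G2_cross (SG Sg)) wg wJg !(crossDl, crossDr, crossZl, crossZr, crossNr).
    rewrite !crossvv (crossC (w *m J)) !scaler0 subr0 add0r.
    by rewrite !scalerN opprK !scalerA -scalerDl !expr2.
  have := G2_dot (SG Sg) (cross w (w *m J)) (cross w (w *m J)).
  rewrite ug dotZl dotZr -[RHS]mul1r mulrA => /(mulIf (_ : _ != 0)).
  rewrite dot_eq0 => /(_ u0) /eqP; rewrite -expr2 sqrf_eq1 => /orP[/eqP->|/eqP ab].
    by rewrite scale1r.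
  by exfalso; have := sqr_ge0 a; have := sqr_ge0 b; lra.
have eig g : S g -> exists a : R, w *m g = a *: w.
  move=> Sg; have [a [b Wg]] := minimal_stable_quadratic mW (SCr g Sg) Sg.
  have b0 : b = 0 by apply/eqP/negPn/negP => b0; apply: nb; exists g, a, b.
  exists a; move: Wg; rewrite b0 expr0n oppr0 scale0r => Wg.
  have SK h : S h -> h *m (g - a%:M) = (g - a%:M) *m h.
    by move=> Sh; rewrite mulmxBr mulmxBl SCr// scalar_mxC.
  suff : W *m (g - a%:M) = 0.
    move=> WK; apply/eqP; rewrite -subr_eq0 -mul_mx_scalar -mulmxBr.
    by have /submxP[D ->] := wW; rewrite -mulmxA WK mulmx0.
  have [//|/rowV0Pn[y yW y0]] := eqVneq (W *m (g - a%:M)) 0.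
  apply: (minimal_stable_kernel mW SK _ y0).
    rewrite (submx_trans yW)// mulmxBr mul_mx_scalar.
    by rewrite addmx_sub ?eqmx_opp ?scalemx_sub ?TW.
  by have /submxP[D ->] := yW; rewrite -mulmxA Wg mulmx0.
exists w => // g Sg; have [h Sh <-] := Ssqrt g Sg; have [a wh] := eig h Sh.
have := G2_dot (SG Sh) w w; rewrite wh dotZl dotZr -[RHS]mul1r mulrA.
move=> /(mulIf (_ : _ != 0)); rewrite dot_eq0 => /(_ w0) a2.
by rewrite mulmxA wh -scalemxAl wh scalerA a2 scale1r.
Qed.
End Fix.
End Frames.

(** * Angles measured in turns *)

Section Turn.
Variable R : realType.
Implicit Types x y a b : R.

Definition turn_cos x : R := cos (2 * pi * x).

Definition turn_sin x : R := sin (2 * pi * x).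

Lemma turn_cosD x y : turn_cos (x + y) = turn_cos x * turn_cos y - turn_sin x * turn_sin y.
Proof. by rewrite /turn_cos mulrDr cosD. Qed.

Lemma turn_sinD x y : turn_sin (x + y) = turn_sin x * turn_cos y + turn_cos x * turn_sin y.
Proof. by rewrite /turn_sin mulrDr sinD. Qed.

Lemma turn_cosN x : turn_cos (- x) = turn_cos x.
Proof. by rewrite /turn_cos mulrN cosN. Qed.

Lemma turn_sinN x : turn_sin (- x) = - turn_sin x.
Proof. by rewrite /turn_sin mulrN sinN. Qed.

Lemma turn_cos_int x : x \is a Num.int -> turn_cos x = 1.
Proof.
move=> /intrP[k ->].
have nat_case (m : nat) : turn_cos m%:R = 1.
  elim: m => [|m IH]; first by rewrite /turn_cos mulr0 cos0.
  rewrite -natr1 turn_cosD IH (_ : turn_cos 1 = 1); last first.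
    by rewrite /turn_cos mulr1 mulr_natl cos2pi.
  rewrite (_ : turn_sin 1 = 0) ?mulr0 ?subr0 ?mulr1//.
  by rewrite /turn_sin mulr1 mulr_natl sin2pi.
by case: k => m; rewrite ?NegzE ?rmorphN /= ?turn_cosN nat_case.
Qed.

Lemma turn_sin0 x : turn_cos x = 1 -> turn_sin x = 0.
Proof. by move=> h; apply: cos1sin0; rewrite -/(turn_cos x) h normr1. Qed.

(** Reduce x to its fractional part r; since cos(2 pi r) = 1 - 2 sin(pi r)^2
    and sin is positive inside (0, pi), r must vanish. *)
Lemma turn_cos_eq1 x : turn_cos x = 1 <-> x \is a Num.int.
Proof.
split=> [c1|]; last exact: turn_cos_int.
set r := x - (Num.floor x)%:~R.
have zr : turn_cos (- (Num.floor x)%:~R) = 1 by rewrite turn_cos_int// rpredN intr_int.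
have cr : turn_cos r = 1.
  by rewrite turn_cosD c1 zr (turn_sin0 c1) mul0r subr0 mulr1.
have r0 : 0 <= r by rewrite subr_ge0 floor_le_tmp.
have r1 : r < 1 by rewrite ltrBlDl; have := floorD1_gt x; rewrite intrD.
have s0 : sin (pi * r) = 0.
  have := cr; rewrite /turn_cos -mulrA mulr_natl cos_mulr2n cos2sin2 => h.
  apply/eqP; rewrite -sqrf_eq0; apply/eqP; move: h; rewrite -mulr_natl; lra.
have [r0'|] := eqVneq r 0.
  by move/eqP : r0'; rewrite subr_eq0 => /eqP ->; rewrite intr_int.
move=> rn0; have : 0 < sin (pi * r).
  apply: sin_gt0_pi; apply/andP; split.
    by rewrite mulr_gt0 ?pi_gt0// lt_def rn0.
  by rewrite gtr_pMr// pi_gt0.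
by rewrite s0 ltxx.
Qed.

Lemma exists_turn a b : a ^+ 2 + b ^+ 2 = 1 ->
  exists x, turn_cos x = a /\ turn_sin x = b.
Proof.
move=> ab.
have a1 : -1 <= a <= 1.
  by have := sqr_ge0 b => hb; apply/andP; split; nra.
have p0 : pi != 0 :> R by rewrite gt_eqF// pi_gt0.
pose t := acos a.
have ct : cos t = a by rewrite acosK.
have st : sin t = `|b|.
  by rewrite sin_acos// -ab addrAC subrr add0r sqrtr_sqr.
have [b0|b0] := leP 0 b.
  exists (t / (2 * pi)); rewrite /turn_cos /turn_sin mulrC mulfVK ?mulf_neq0//.
  by rewrite ct st ger0_norm.
exists (- (t / (2 * pi))); rewrite turn_cosN turn_sinN /turn_cos /turn_sin.
rewrite (mulrC (2 * pi)) mulfVK ?mulf_neq0//.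
by rewrite ct st ltr0_norm// opprK.
Qed.

End Turn.

(** * The torus as a compact Hausdorff group *)

Section TorusTheory.
Variables (R : realType) (n : nat).
Implicit Types x y : 'rV[R]_n.
Notation texp := (@torus_exp R n).

Lemma int_latticeP x : reflect (forall j, x 0 j \is a Num.int) (int_lattice x).
Proof. exact: forallP. Qed.

Lemma torus_expD x y : texp (x + y) = texp x + texp y.
Proof. exact: Quotient.pi_add. Qed.

Lemma torus_expN x : texp (- x) = - texp x.
Proof. exact: Quotient.pi_opp. Qed.

Lemma torus_exp0 : texp 0 = 0.
Proof. by have := torus_expD 0 0; rewrite addr0 => /eqP; rewrite -subr_eq subrr => /eqP. Qed.

Lemma torus_exp_eq0 x : (texp x = 0) <-> int_lattice x.
Proof.
rewrite -torus_exp0; have := Quotient.idealrBE (Algebra.ZmodClosed.clone 'rV[R]_n (@int_lattice R n) _) x 0.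
by rewrite subr0 => h; split=> [h1|h1]; [change (x \in (@int_lattice R n)); rewrite h; apply/eqP|apply/eqP; rewrite -h].
Qed.

Lemma torus_exp_eq x y : (texp x = texp y) <-> int_lattice (x - y).
Proof. 
rewrite -torus_exp_eq0 torus_expD torus_expN; split => [->|/eqP].
  by rewrite subrr.
by rewrite subr_eq0 => /eqP.
Qed.

Lemma torus_exp_repr (t : torus R n) : texp (repr t) = t.
Proof. exact: reprK. Qed.

Lemma torus_exp_continuous : continuous texp.
Proof. by apply/continuousP => U. Qed.

Lemma torus_unit_cube (t : torus R n) :
  exists2 x : 'rV[R]_n, (forall i, `[0, 1]%classic (x 0 i)) & texp x = t.
Proof.
pose x := repr t; exists (\row_i (x 0 i - (Num.floor (x 0 i))%:~R)).
  move=> i; rewrite mxE /= in_itv /= subr_ge0 floor_le_tmp /= lerBlDl ltW//.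
  by have := floorD1_gt (x 0 i); rewrite intrD.
rewrite -[RHS]torus_exp_repr torus_exp_eq; apply/int_latticeP => i.
by rewrite !mxE addrAC subrr add0r rpredN intr_int.
Qed.

Lemma unit_cube_compact : compact [set x : 'rV[R]_n | forall i, `[0, 1]%classic (x 0 i)].
Proof. by apply: (@rV_compact R n (fun=> `[0, 1]%classic)) => i; exact: segment_compact. Qed.

Lemma torus_compact : compact [set: torus R n].
Proof.
have := @continuous_compact _ _ texp _ _ unit_cube_compact.
rewrite (_ : [set texp x | x in _] = setT); first apply.
  by apply: continuous_subspaceT; exact: torus_exp_continuous.
by apply/seteqP; split=> // t _; have [x xc <-] := torus_unit_cube t; exists x.
Qed.

(** A continuous function of period 1 of one coordinate descends to the torus;
    here it is evaluated on an arbitrary representative. *)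
Lemma torus_coord_continuous (f : R -> R) i : continuous f ->
  (forall a b : R, a - b \is a Num.int -> f a = f b) ->
  continuous (fun t : torus R n => f ((repr t : 'rV[R]_n) 0 i)).
Proof.
move=> cf pf; apply/continuousP => U oU.
change (open (texp @^-1` ((fun t : torus R n => f ((repr t : 'rV[R]_n) 0 i)) @^-1` U))).
rewrite (_ : _ @^-1` _ = (fun x : 'rV[R]_n => f (x 0 i)) @^-1` U).
  have : continuous (fun x : 'rV[R]_n => f (x 0 i)).
    by move=> x; apply: continuous_comp (cf _); exact: coord_continuous.
  by move/continuousP; exact.
apply/seteqP; split=> x /=.
  rewrite (pf _ (x 0 i))//.
  have /torus_exp_eq/int_latticeP/(_ i) := torus_exp_repr (texp x).
  by rewrite !mxE.
rewrite (pf _ ((repr (texp x) : 'rV[R]_n) 0 i))//.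
have /esym/torus_exp_eq/int_latticeP/(_ i) := torus_exp_repr (texp x).
by rewrite !mxE.
Qed.

Lemma cluster_continuous_eq (T : topologicalType) (f : T -> R) (p q : T) :
  continuous f -> cluster (nbhs p) q -> f p = f q.
Proof.
move=> cf pq; apply: (@Rhausdorff R) => A B fpA fqB.
by have [t [tA tB]] := pq _ _ (cf p _ fpA) (cf q _ fqB); exists (f t).
Qed.

(** The functions cos(2 pi x_j) and sin(2 pi x_j) descend to the torus and
    separate its points. *)
Lemma torus_hausdorff : hausdorff_space (torus R n).
Proof.
move=> p q pq; rewrite -(torus_exp_repr p) -(torus_exp_repr q) torus_exp_eq.
apply/int_latticeP => i; rewrite !mxE; apply/turn_cos_eq1.
have ctc : continuous (@turn_cos R).
  move=> x; apply: continuous_comp; last exact: continuous_cos.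
  exact: mulrl_continuous.
have cts : continuous (@turn_sin R).
  move=> x; apply: continuous_comp; last exact: continuous_sin.
  exact: mulrl_continuous.
have ec (x y : R) : x - y \is a Num.int -> turn_cos x = turn_cos y.
  move=> /turn_cos_eq1 h; rewrite -(subrK y x) turn_cosD h (turn_sin0 h).
  by rewrite mul0r mul1r subr0.
have es (x y : R) : x - y \is a Num.int -> turn_sin x = turn_sin y.
  move=> /turn_cos_eq1 h; rewrite -(subrK y x) turn_sinD h (turn_sin0 h).
  by rewrite mul0r mul1r add0r.
have C := cluster_continuous_eq (torus_coord_continuous (i := i) ctc ec) pq.
have S := cluster_continuous_eq (torus_coord_continuous (i := i) cts es) pq.
rewrite turn_cosD turn_cosN turn_sinN {}C {}S mulrN opprK -!expr2.
exact: cos2Dsin2.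
Qed.

End TorusTheory.

Lemma compact_continuous_inverse (T U : topologicalType) (f : T -> U) (g : U -> T) :
  compact [set: T] -> hausdorff_space U -> continuous f -> cancel f g ->
  {within range f, continuous g}.
Proof.
move=> cT hU cf fg; apply/continuous_closedP => C cC.
have fC : closed (f @` C).
  apply: compact_closed => //; apply: continuous_compact.
    exact: continuous_subspaceT.
  by rewrite -(setTI C); apply: compact_closedI.
apply/closed_subspaceP; exists (f @` C) => //.
apply/seteqP; split=> y [] /=.
  move=> [x Cx <-] _; split; last by exists x.
  by rewrite /from_subspace fg.
by rewrite /from_subspace => Cgy [x _ xy]; split; exists x => //; rewrite -xy fg in Cgy.
Qed.

Lemma connected_rV (R : realType) (n : nat) : connected [set: 'rV[R]_n].
Proof.
have -> : [set: 'rV[R]_n] = \bigcup_(v in setT) ((fun s : R => s *: v) @` `[0, 1]%classic).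
  apply/seteqP; split=> // v _; exists v => //; exists 1; last by rewrite scale1r.
  by rewrite /= in_itv /= ler01 lexx.
apply: bigcup_connected.
  exists 0 => v _; exists 0; last by rewrite scale0r.
  by rewrite /= in_itv /= ler01 lexx.
move=> v _; apply: connected_continuous_connected; first exact: segment_connected.
by apply: continuous_subspaceT => s; exact: scalel_continuous.
Qed.

(** * One-parameter groups of rotations *)

Lemma is_derive_translate (R : realType) (V : normedModType R) (f g : R -> V) (s : R) (df : V) :
  (forall h, f (s + h) = g h) -> is_derive (0 : R) 1 g df -> is_derive s 1 f df.
Proof.
move=> fg [dg gE].
have E : (fun h : R => h^-1 *: ((f \o shift s) (h *: 1) - f s)) =
         (fun h : R => h^-1 *: ((g \o shift 0) (h *: 1) - g 0)).
  apply/funext => h /=; have -> : f s = g 0 by rewrite -fg addr0.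
  by rewrite addr0 (addrC _ s) fg.
split; first by rewrite /derivable E.
by rewrite /derive E.
Qed.

Section OneParameter.
Variable R : realType.
Variables (a b : R -> R) (m : R).
Hypothesis aD : forall s t, a (s + t) = a s * a t - b s * b t.
Hypothesis bD : forall s t, b (s + t) = b s * a t + a s * b t.
Hypothesis ab1 : forall s, a s ^+ 2 + b s ^+ 2 = 1.
Hypotheses (a0 : a 0 = 1) (da : derivable a (0 : R) 1) (hb : is_derive (0 : R) 1 b m).

(** The group law gives a' = - m b and b' = m a everywhere from the derivatives
    at 0, the derivative of a at 0 being 0 because a^2 + b^2 is constant.
    Rotating (a, b) back by the angle m s yields a pair with zero derivative.
    *)
Lemma one_parameter_circle s : a s = cos (m * s) /\ b s = sin (m * s).
Proof.
have b0 : b 0 = 0.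
  by have /eqP := ab1 0; rewrite a0 expr1n -subr_eq0 addrAC subrr add0r sqrf_eq0 => /eqP.
have ha : is_derive (0 : R) 1 a 0.
  have := derivableP da; set l := 'D_1 a 0 => hl.
  have h2 : is_derive (0 : R) (1 : R) (a * a + b * b) (2 * l).
    apply: is_derive_eq (is_deriveD (is_deriveM hl hl) (is_deriveM hb hb)) _.
    by rewrite /GRing.scale /= a0 b0; ring.
  have h1 : is_derive (0 : R) (1 : R) (a * a + b * b) (0 : R).
    have -> : a * a + b * b = cst 1 by apply/funext => x; rewrite !fctE -(ab1 x) !expr2.
    exact: is_derive_cst.
  have E : 2 * l = 0 by rewrite -(@derive_val _ _ _ _ _ _ _ h2) (@derive_val _ _ _ _ _ _ _ h1).
  move/eqP: E; rewrite mulf_eq0 => /orP[|/eqP l0]; first by rewrite pnatr_eq0.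
  by rewrite l0 in hl.
have Ha x : is_derive x (1 : R) a (- m * b x).
  have h : is_derive (0 : R) (1 : R) (a x *: a - b x *: b) (- m * b x).
    apply: is_derive_eq (is_deriveB (is_deriveZ (a x) ha) (is_deriveZ (b x) hb)) _.
    by rewrite /GRing.scale /=; ring.
  exact: (is_derive_translate (aD x) h).
have Hb x : is_derive x (1 : R) b (m * a x).
  have h : is_derive (0 : R) (1 : R) (b x *: a + a x *: b) (m * a x).
    apply: is_derive_eq (is_deriveD (is_deriveZ (b x) ha) (is_deriveZ (a x) hb)) _.
    by rewrite /GRing.scale /=; ring.
  exact: (is_derive_translate (bD x) h).
pose co x := cos (m * x); pose si x := sin (m * x).
have hm x : is_derive x (1 : R) (fun x => m * x) m.
  have -> : (fun x => m * x) = m *: (@id R) by apply/funext.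
  by apply: is_derive_eq; rewrite /GRing.scale /= mulr1.
have Hc x : is_derive x (1 : R) co (- m * si x).
  have := is_derive1_comp (is_derive_cos (m * x)) (hm x).
  by rewrite mulNr -mulNr mulrC mulrN -mulNr.
have Hs x : is_derive x (1 : R) si (m * co x).
  have := is_derive1_comp (is_derive_sin (m * x)) (hm x).
  by rewrite mulrC.
have HP x : is_derive x (1 : R) (a * co + b * si) 0.
  apply: is_derive_eq (is_deriveD (is_deriveM (Ha x) (Hc x)) (is_deriveM (Hb x) (Hs x))) _.
  by rewrite /GRing.scale /=; ring.
have HQ x : is_derive x (1 : R) (b * co - a * si) 0.
  apply: is_derive_eq (is_deriveB (is_deriveM (Hb x) (Hc x)) (is_deriveM (Ha x) (Hs x))) _.
  by rewrite /GRing.scale /=; ring.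
have P x : a x * co x + b x * si x = 1.
  rewrite -[LHS]/((a * co + b * si) x) (is_derive_0_is_cst x 0 HP).
  by rewrite !fctE /co /si !mulr0 cos0 sin0 a0 b0 mulr1 mul0r addr0.
have Q x : b x * co x - a x * si x = 0.
  rewrite -[LHS]/((b * co - a * si) x) (is_derive_0_is_cst x 0 HQ).
  by rewrite !fctE /co /si !mulr0 cos0 sin0 a0 b0 mulr0 mul0r subr0.
have cs : co s ^+ 2 + si s ^+ 2 = 1 by exact: cos2Dsin2.
rewrite -/(co s) -/(si s); split.
  transitivity (co s * (a s * co s + b s * si s) - si s * (b s * co s - a s * si s)).
    by rewrite -[LHS]mulr1 -cs; ring.
  by rewrite P Q mulr1 mulr0 subr0.
transitivity (si s * (a s * co s + b s * si s) + co s * (b s * co s - a s * si s)).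
  by rewrite -[LHS]mulr1 -cs; ring.
by rewrite P Q mulr1 mulr0 addr0.
Qed.
End OneParameter.

(** * Subgroups of a torus separated by enough characters *)

Lemma mulmxr_differentiable (R : realType) (m n : nat) (P : 'M[R]_(m, n)) x :
  differentiable (fun x : 'rV[R]_m => x *m P) x.
Proof.
have -> : (fun x : 'rV[R]_m => x *m P) = \sum_(i < m) (fun x : 'rV[R]_m => x 0 i *: row i P).
  by apply/funext => y; rewrite mulmx_sum_row fct_sumE.
apply: differentiable_sum => i; apply: differentiableZl; exact: differentiable_coord.
Qed.

Lemma mulmxr_continuous (R : realType) (m n : nat) (P : 'M[R]_(m, n)) :
  continuous (fun x : 'rV[R]_m => x *m P).
Proof. by move=> x; exact/differentiable_continuous/mulmxr_differentiable. Qed.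

Section TorusStructure.
Variables (R : realType) (n m q : nat).
(** H is a subgroup whose Lie algebra is the kernel of L, and the functions
    a_j + i b_j restrict to m characters of H, given on the Lie algebra by
    the columns of l, which together are injective on H. If m is at most the
    dimension of H, the characters identify H with the torus of dimension m. *)
Variables (H : set (torus R n)) (L : 'M[R]_(n, q)) (l : 'M[R]_(n, m)).
Variables (a b : 'I_m -> 'rV[R]_n -> R).
Implicit Types X Y : 'rV[R]_n.
Local Notation texp := (@torus_exp R n).
Local Notation G X := (H (texp X)).

Hypothesis H_addr : forall s t, H s -> H t -> H (s + t).
Hypothesis kerL_H : forall X, X *m L = 0 -> G X.
Hypothesis lie_kerL : forall X, lie_algebra H X -> X *m L = 0.
Hypothesis rank_kerL : (m <= \rank (kermx L))%N.
Hypothesis aE : forall j X, X *m L = 0 -> a j X = turn_cos ((X *m l) 0 j).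
Hypothesis bE : forall j X, X *m L = 0 -> b j X = turn_sin ((X *m l) 0 j).
Hypothesis aD : forall j X Y, G X -> G Y -> a j (X + Y) = a j X * a j Y - b j X * b j Y.
Hypothesis bD : forall j X Y, G X -> G Y -> b j (X + Y) = b j X * a j Y + a j X * b j Y.
Hypothesis ab1 : forall j X, G X -> a j X ^+ 2 + b j X ^+ 2 = 1.
Hypothesis a_exp0 : forall j X, texp X = 0 -> a j X = 1.
Hypothesis faithful : forall X, G X -> (forall j, a j X = 1 /\ b j X = 0) -> texp X = 0.

(** No line through the origin, except the zero one, stays in the lattice: s x
    would have to be an integer for s = 1 / (2x). *)
Lemma torus_exp_line0 X : (forall s : R, texp (s *: X) = 0) -> X = 0.
Proof.
move=> h; apply/rowP => i; rewrite mxE; apply/eqP/negPn/negP => Xi.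
have /torus_exp_eq0/int_latticeP/(_ i) := h ((2 * X 0 i)^-1).
rewrite mxE invfM -mulrA mulVf// mulr1 => /intrP[z hz].
have : (2%:~R * z%:~R : R) == 1%:~R by rewrite -hz mulfV.
rewrite -intrM eqr_int => /eqP h2.
have : ((2 : int) %| 1)%Z by apply/dvdzP; exists z; rewrite mulrC.
by [].
Qed.

(** If all the characters are trivial along the line of X, that line lies in
    the integral lattice. *)
Lemma kerL_character_inj X : X *m L = 0 -> X *m l = 0 -> X = 0.
Proof.
move=> XL Xl; apply: torus_exp_line0 => s.
have sL : s *: X *m L = 0 by rewrite -scalemxAl XL scaler0.
apply: faithful; first exact: kerL_H.
move=> j; rewrite aE// bE// -scalemxAl Xl scaler0 mxE.
by rewrite /turn_cos /turn_sin mulr0 cos0 sin0.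
Qed.

(** By [kerL_character_inj] the derivatives of the characters embed the Lie
    algebra in R^m; the bound on the rank makes the embedding an isomorphism.
    The rows of P are the inverse images of the coordinate vectors. *)
Lemma kerL_section : exists P : 'M[R]_(m, n), P *m L = 0 /\ P *m l = 1%:M.
Proof.
pose B := row_base (kermx L).
have BL : B *m L = 0 by apply/sub_kermxP; rewrite eq_row_base.
have free : row_free (B *m l).
  rewrite -kermx_eq0; apply/eqP/row_matrixP => i; rewrite row0.
  apply: (row_free_inj (row_base_free (kermx L))); rewrite mul0mx.
  apply: kerL_character_inj; first by rewrite -mulmxA BL mulmx0.
  by rewrite -mulmxA; apply/sub_kermxP/row_sub.
have full : row_full (B *m l).
  rewrite /row_full eqn_leq rank_leq_col /=; move/eqP: free => ->.
  exact: rank_kerL.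
exists (pinvmx (B *m l) *m B); split; first by rewrite -mulmxA BL mulmx0.
by rewrite -mulmxA mulVpmx.
Qed.

Section WithSection.
Variable P : 'M[R]_(m, n).
Hypotheses (PL : P *m L = 0) (Pl : P *m l = 1%:M).

Lemma kerL_sectionK X : X *m L = 0 -> X *m l *m P = X.
Proof.
move=> XL; apply/esym/eqP; rewrite -subr_eq0; apply/eqP/kerL_character_inj.
  by rewrite mulmxBl XL -(mulmxA _ P) PL mulmx0 subrr.
by rewrite mulmxBl -(mulmxA _ P) Pl mulmx1 subrr.
Qed.

Lemma mulP_kerL (x : 'rV[R]_m) : x *m P *m L = 0.
Proof. by rewrite -mulmxA PL mulmx0. Qed.

Lemma mulP_char (x : 'rV[R]_m) j : a j (x *m P) = turn_cos (x 0 j) /\ b j (x *m P) = turn_sin (x 0 j).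
Proof. by rewrite aE ?bE ?mulP_kerL// -mulmxA Pl mulmx1. Qed.

(** The characters take the value e^(2 pi i x_j) at x *m P, and they are
    jointly injective. *)
Lemma torus_exp_mulP_eq0 (x : 'rV[R]_m) : texp (x *m P) = 0 <-> int_lattice x.
Proof.
split=> [h|/int_latticeP h].
  apply/int_latticeP => j; apply/turn_cos_eq1.
  by rewrite -(mulP_char x j).1; exact: a_exp0.
apply: faithful; first exact/kerL_H/mulP_kerL.
move=> j; have := h j; have [-> ->] := mulP_char x j.
by move=> /turn_cos_eq1 h1; rewrite h1 turn_sin0.
Qed.

Definition torus_param (t : torus R m) : torus R n := texp ((repr t : 'rV[R]_m) *m P).

Lemma torus_paramE x : torus_param (torus_exp x) = texp (x *m P).
Proof.
apply/torus_exp_eq; rewrite -mulmxBl -torus_exp_eq0.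
by apply/torus_exp_mulP_eq0/torus_exp_eq/torus_exp_repr.
Qed.

Lemma torus_param_morph : {morph torus_param : s t / s + t}.
Proof.
move=> s t; rewrite -(torus_exp_repr s) -(torus_exp_repr t) -torus_expD.
by rewrite !torus_paramE mulmxDl torus_expD.
Qed.

Lemma torus_param_inj : injective torus_param.
Proof.
move=> s t; rewrite -(torus_exp_repr s) -(torus_exp_repr t) !torus_paramE.
by move/torus_exp_eq; rewrite -mulmxBl -torus_exp_eq0 => /torus_exp_mulP_eq0/torus_exp_eq.
Qed.

Lemma torus_exp_mulP_continuous : continuous (fun x : 'rV[R]_m => texp (x *m P)).
Proof.
move=> x; apply: (@continuous_comp _ _ _ (fun y : 'rV[R]_m => y *m P) (@torus_exp R n)).
  exact: mulmxr_continuous.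
exact: torus_exp_continuous.
Qed.

Lemma torus_param_continuous : continuous torus_param.
Proof.
apply/continuousP => U oU.
change (open (@torus_exp R m @^-1` (torus_param @^-1` U))).
rewrite (_ : _ @^-1` _ = (fun x => texp (x *m P)) @^-1` U).
  by move/continuousP: torus_exp_mulP_continuous; exact.
by apply/seteqP; split=> x; rewrite /= torus_paramE.
Qed.

(** Given h in H, choose x having the angles of the characters of h as
    coordinates; the quotient of h and the image of x is killed by every
    character. *)
Lemma torus_param_range : torus_param @` setT = H.
Proof.
apply/seteqP; split=> [_ [t _ <-]|h Hh].
  by apply: kerL_H; exact: mulP_kerL.
have GY : G (repr h) by rewrite torus_exp_repr.
set Y : 'rV[R]_n := repr h in GY.
have [x xE] : exists x : 'rV[R]_m, forall j, turn_cos (x 0 j) = a j Y /\ turn_sin (x 0 j) = b j Y.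
  have /choice[x xE] j := exists_turn (ab1 j GY).
  by exists (\row_j x j) => j; rewrite mxE.
exists (torus_exp x) => //; rewrite torus_paramE.
have GNx : G ((- x) *m P) by apply/kerL_H/mulP_kerL.
apply/esym; rewrite -(torus_exp_repr h) -/Y.
apply/torus_exp_eq; rewrite -torus_exp_eq0 -mulNmx.
apply: faithful.
  have := H_addr GY GNx; by rewrite torus_expD.
move=> j; rewrite aD// bD//; have [-> ->] := mulP_char (- x) j.
rewrite mxE turn_cosN turn_sinN -(xE j).1 -(xE j).2; split; last by ring.
by rewrite mulrN opprK -!expr2; exact: cos2Dsin2.
Qed.

Lemma torus_param_connected : connected H.
Proof.
have -> : H = (fun x => texp (x *m P)) @` [set: 'rV[R]_m].
  rewrite -torus_param_range; apply/seteqP; split=> [_ [t _ <-]|_ [x _ <-]].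
    by exists (repr t).
  by exists (torus_exp x) => //; rewrite torus_paramE.
apply: connected_continuous_connected; first exact: connected_rV.
exact/continuous_subspaceT/torus_exp_mulP_continuous.
Qed.

Lemma torus_param_iso : isomorphic_to_torus H m.
Proof.
pose g y := xget 0 [set t | torus_param t = y].
have fg : cancel torus_param g.
  move=> t; apply: torus_param_inj; rewrite /g.
  exact: (@xgetPex _ 0 [set s | torus_param s = torus_param t] (ex_intro _ t erefl)).
exists torus_param, g; split.
- exact: torus_param_morph.
- exact: torus_param_range.
- exact: fg.
- exact: torus_param_continuous.
rewrite -torus_param_range; apply: compact_continuous_inverse fg.
- exact: torus_compact.
- exact: torus_hausdorff.
- exact: torus_param_continuous.
Qed.

Lemma torus_param_lie_dim : lie_dim H m.
Proof.
pose f : 'Hom('rV[R]_m, 'rV[R]_n) := linfun (mulmxr P).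
have fE x : f x = x *m P by rewrite lfunE.
exists (limg f); split.
  move=> X; split=> [/memv_imgP[x _ ->] s|/lie_kerL XL].
    by apply: kerL_H; rewrite fE scalemxAl mulP_kerL.
  by rewrite -(kerL_sectionK XL) -fE memv_img// memvf.
rewrite limg_dim_eq ?dimvf ?dim_matrix; first exact: mul1n.
apply/eqP; rewrite -subv0; apply/subvP => x; rewrite memv_cap memv_ker fE memv0.
move=> /andP[_ /eqP xP]; apply/eqP.
by rewrite -[x]mulmx1 -Pl mulmxA xP mul0mx.
Qed.

End WithSection.

Theorem torus_structure :
  [/\ connected H, lie_dim H m & isomorphic_to_torus H m].
Proof.
have [P [PL Pl]] := kerL_section.
split; [exact: torus_param_connected PL Pl|exact: torus_param_lie_dim PL Pl|].
exact: torus_param_iso PL Pl.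
Qed.

End TorusStructure.

(** * Vector-valued calculus *)

Section Calculus.
Variable R : realType.

Lemma mx_entry_le_norm (m n : nat) (x : 'M[R]_(m, n)) i j : `|x i j| <= `|x|.
Proof. by rewrite [leRHS]/Num.Def.normr /= mx_normrE; exact: (le_bigmax _ _ (i, j)). Qed.

Lemma mx_norm_le (m n : nat) (x : 'M[R]_(m, n)) (e : R) : 0 <= e ->
  (forall i j, `|x i j| <= e) -> `|x| <= e.
Proof.
by move=> e0 xe; rewrite [leLHS]/Num.Def.normr /= mx_normrE bigmax_le.
Qed.

(** The mean value theorem holds for each coordinate, and the norm is the
    maximum of the coordinates. *)
Lemma mean_value_rV (n : nat) (f df : R -> 'rV[R]_n) (e : R) : 0 <= e ->
  (forall s : R, 0 <= s <= 1 -> is_derive s (1 : R) f (df s)) ->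
  (forall s : R, 0 <= s <= 1 -> `|df s| <= e) -> `|f 1 - f 0| <= e.
Proof.
move=> e0 fdf dfe; apply: mx_norm_le => // i j; rewrite ord1 {i}.
have h (s : R) : 0 <= s <= 1 -> is_derive s (1 : R) (fun s => f s 0 j) (df s 0 j).
  move=> s01; have [fd fE] := fdf s s01; split.
    by apply: (derivable_mxP _ _ _).1.
  by rewrite -fE derive_mx// mxE.
have [||c c01 fc] := @MVT_segment R (fun s => f s 0 j) (fun s => df s 0 j) 0 1 ler01.
- by move=> s; rewrite in_itv /= => /andP[s0 s1]; apply: h; rewrite !ltW.
- apply: derivable_within_continuous => s; rewrite in_itv /= => s01.
  exact: (@ex_derive _ _ _ _ _ _ _ (h s s01)).
rewrite !mxE fc subr0 mulr1; apply: le_trans (dfe c c01).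
exact: mx_entry_le_norm.
Qed.

Lemma is_derive_curve_comp (V W : normedModType R) (f : V -> W) (g : R -> V) (s : R) (v : V) :
  differentiable f (g s) -> is_derive s (1 : R) g v ->
  is_derive s (1 : R) (f \o g) ('d f (g s) v).
Proof.
move=> fd [gd gE].
have gdiff : differentiable g s by apply/derivable1_diffP.
have fgd : differentiable (f \o g) s by exact: differentiable_comp.
split; first by apply/derivable1_diffP.
by rewrite deriveE// diff_comp//= -gE deriveE.
Qed.

Lemma is_derive_line (V : normedModType R) (x v : V) (s : R) :
  is_derive s (1 : R) (fun s => x + s *: v) v.
Proof.
have h : is_derive s (1 : R) (fun s : R => s *: v) v.
  have d : is_diff s (fun s : R => s *: v) (fun s : R => s *: v).
    exact: is_diff_scalel.
  split; first exact/derivable1_diffP.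
  by rewrite deriveE// diff_val scale1r.
have -> : (fun s : R => x + s *: v) = cst x + (fun s : R => s *: v) by [].
by apply: is_derive_eq (is_deriveD (is_derive_cst x s 1) h) _; rewrite add0r.
Qed.

Lemma near_eq_diff (V W : normedModType R) (f g : V -> W) (x v : V) :
  differentiable f x -> differentiable g x ->
  (\forall y \near x, f y = g y) -> 'd f x v = 'd g x v.
Proof. by move=> df dg fg; rewrite -!deriveE//; exact: near_eq_derive. Qed.

End Calculus.

(** * A smooth torus action in a chart *)

Section SmoothAction.
Variables (R : realType) (k n : nat) (M : manifold R n) (act : torus R k -> M -> M).
Hypotheses (act_action : is_action act) (act_smooth : is_smooth act).
Implicit Types (X Y : 'rV[R]_k) (x y v : 'rV[R]_n).
Local Notation texp := (@torus_exp R k).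

Lemma act0 p : act 0 p = p.
Proof. exact: act_action.1. Qed.

Lemma actD s t p : act (s + t) p = act s (act t p).
Proof. exact: act_action.2. Qed.

Section Chart.
Variable c : chart R n M.
Hypothesis cA : atlas c.

(** The joint local expression of the action, with the same chart at the source
    and at the target: near a fixed point no other charts are needed. *)
Definition act_coord (z : 'rV[R]_k * 'rV[R]_n) : 'rV[R]_n :=
  c (act (texp z.1) (chart_inv c z.2)).

Definition act_coord_dom : set ('rV[R]_k * 'rV[R]_n) :=
  [set z | (c @` chart_dom c) z.2 /\ chart_dom c (act (texp z.1) (chart_inv c z.2))].

Lemma chart_cod_dom x : (c @` chart_dom c) x -> chart_dom c (chart_inv c x) /\ c (chart_inv c x) = x.
Proof. by move=> [p cp <-]; rewrite chartK. Qed.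

Lemma act_coord_dom_near z : act_coord_dom z -> \forall z' \near z, act_coord_dom z'.
Proof.
move=> [z2 z12].
have h1 : \forall z' \near z, (c @` chart_dom c) z'.2.
  apply: (cvg_snd (open_nbhs_nbhs _)); split=> //; exact: chart_cod_open.
have h2 : \forall z' \near z, chart_dom c (act (texp z'.1) (chart_inv c z'.2)).
  have ch : {for z, continuous (fun z : 'rV[R]_k * 'rV[R]_n => act (texp z.1) (chart_inv c z.2))}.
    apply: (@continuous_comp _ _ _ (fun z => (texp z.1, chart_inv c z.2))
       (fun w : torus R k * M => act w.1 w.2)); last exact: act_smooth.1.
    apply: (@cvg_pair _ _ _ (nbhs z) (nbhs (texp z.1)) (nbhs (chart_inv c z.2)) _ _ _
      (fun z => texp z.1) (fun z => chart_inv c z.2)).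
      apply: (@continuous_comp _ _ _ (@fst 'rV[R]_k 'rV[R]_n) (@torus_exp R k)); [exact: cvg_fst|exact: torus_exp_continuous].
    apply: (@continuous_comp _ _ _ (@snd 'rV[R]_k 'rV[R]_n) (chart_inv c)); [exact: cvg_snd|exact: chart_inv_continuous].
  by apply: ch; apply: open_nbhs_nbhs; split; [exact: chart_dom_open|].
by near=> z'; split; near: z'.
Unshelve. all: by end_near. Qed.

Lemma act_coord_diff z : act_coord_dom z -> differentiable act_coord z.
Proof. by have [_ /(_ c c cA cA 1%N)[h _]] := act_smooth; exact: h. Qed.

Lemma act_coord_diff2 z w : act_coord_dom z ->
  differentiable (fun z => 'd act_coord z w) z.
Proof. by have [_ /(_ c c cA cA 2%N)[_ /(_ w)[h _]]] := act_smooth; exact: h. Qed.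

Lemma fiber_diffP X x v : act_coord_dom (X, x) ->
  differentiable (fun y => act_coord (X, y)) x /\
  'd (fun y => act_coord (X, y)) x v = 'd act_coord (X, x) (0, v).
Proof.
move=> Xx; have dp : differentiable (fun y : 'rV[R]_n => (X, y)) x.
  by apply: differentiable_pair.
have dF := act_coord_diff Xx.
split; first exact: (@differentiable_comp _ _ _ _ (fun y => (X, y)) act_coord).
rewrite -[fun y => _]/(act_coord \o (fun y => (X, y))) diff_comp//= diff_pair//=.
by rewrite diff_cst diff_val.
Qed.

End Chart.
End SmoothAction.

(** * The isotropy representation and the orbit map *)

Section Isotropy.
Variables (R : realType) (k n : nat) (M : manifold R n) (act : torus R k -> M -> M).
Hypotheses (act_action : is_action act) (act_smooth : is_smooth act).
Implicit Types (X Y : 'rV[R]_k) (x y v : 'rV[R]_n).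
Local Notation texp := (@torus_exp R k).

Variables (c : chart R n M) (p : M).
Hypotheses (cA : atlas c) (cp : chart_dom c p).
Local Notation F := (act_coord act c).
Local Notation U := (act_coord_dom act c).
Local Notation G X := (isotropy act p (texp X)).

(** The differential at p of the transformation exp X, in the chart c; it is
    the isotropy representation when exp X fixes p. *)
Definition iso_rep X : 'M[R]_n := jacobian (fun y => F (X, y)) (c p).

Lemma cod_chart q : chart_dom c q -> (c @` chart_dom c) (c q).
Proof. by exists q. Qed.

Lemma act_coordE X q : chart_dom c q -> F (X, c q) = c (act (texp X) q).
Proof. by move=> cq; rewrite /act_coord /= chartK. Qed.

Lemma isotropy_dom X : G X -> U (X, c p).
Proof. by move=> GX; split=> /=; [exact: cod_chart|rewrite chartK// GX]. Qed.

Lemma act_coord_fixed X : G X -> F (X, c p) = c p.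
Proof. by move=> GX; rewrite act_coordE// GX. Qed.

Lemma isotropy0 X : texp X = 0 -> G X.
Proof. by move=> X0; rewrite /isotropy /= X0 (act0 act_action). Qed.

Lemma isotropyD X Y : G X -> G Y -> G (X + Y).
Proof. by rewrite /isotropy /= torus_expD (actD act_action) => GX ->. Qed.

Lemma fiber_diff X : G X -> differentiable (fun y => F (X, y)) (c p).
Proof. by move=> /isotropy_dom GX; have [] := fiber_diffP act_smooth cA 0 GX. Qed.

Lemma iso_repE X v : G X -> v *m iso_rep X = 'd F (X, c p) (0, v).
Proof.
move=> /isotropy_dom GX; rewrite /iso_rep /jacobian mul_rV_lin1.
by have [_ ->] := fiber_diffP act_smooth cA v GX.
Qed.

Lemma mul_iso_rep X v : v *m iso_rep X = 'd (fun y => F (X, y)) (c p) v.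
Proof. by rewrite /iso_rep /jacobian mul_rV_lin1. Qed.

(** The group law in coordinates; y is moved out of the chart and back, so its
    image has to lie in the domain of the chart. *)
Lemma act_coord_compose X Y y : U (Y, y) -> F (X + Y, y) = F (X, F (Y, y)).
Proof.
by move=> [_ /= Yy]; rewrite /act_coord /= torus_expD (actD act_action) chartK.
Qed.

Lemma fiber_dom_near X : G X -> \forall y \near c p, U (X, y).
Proof.
move=> /isotropy_dom/(act_coord_dom_near act_smooth) h.
have : {for c p, continuous (fun y : 'rV[R]_n => (X, y))}.
  apply: (@cvg_pair _ _ _ (nbhs (c p)) (nbhs X) (nbhs (c p)) _ _ _ (fun=> X) id).
    exact: cvg_cst.
  exact: cvg_id.
exact.
Qed.

Lemma iso_repD X Y : G X -> G Y -> iso_rep (X + Y) = iso_rep Y *m iso_rep X.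
Proof.
move=> GX GY; have dY := fiber_diff GY.
have FY : F (Y, c p) = c p by exact: act_coord_fixed.
have dX : differentiable (fun y => F (X, y)) (F (Y, c p)) by rewrite FY; exact: fiber_diff.
have dXY : differentiable ((fun y => F (X, y)) \o (fun y => F (Y, y))) (c p).
  exact: differentiable_comp.
have dS := fiber_diff (isotropyD GX GY).
have near_comp : \forall y \near c p,
    F (X + Y, y) = ((fun y => F (X, y)) \o (fun y => F (Y, y))) y.
  by near=> y; apply: act_coord_compose; near: y; exact: fiber_dom_near.
apply/row_matrixP => i; rewrite !rowE mulmxA.
set e := delta_mx _ _.
apply: etrans (mul_iso_rep (X + Y) e) _.
apply: etrans (near_eq_diff e dS dXY near_comp) _.
apply: etrans _ (esym (mul_iso_rep X (e *m iso_rep Y))).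
have := congr1 (fun f => f e) (diff_comp dY dX).
by rewrite FY (mul_iso_rep Y e).
Unshelve. all: by end_near. Qed.

Lemma iso_rep0 X : texp X = 0 -> iso_rep X = 1%:M.
Proof.
move=> X0; apply/row_matrixP => i; rewrite !rowE mulmx1 mul_iso_rep.
have d1 : differentiable (@id 'rV[R]_n) (c p) by exact: ex_diff.
rewrite (near_eq_diff _ (fiber_diff (isotropy0 X0)) d1); first by rewrite diff_val.
near=> y; rewrite /act_coord /= X0 (act0 act_action).
have [|_ ->//] := chart_cod_dom (c := c) (x := y).
near: y; apply: open_nbhs_nbhs; split; [exact: chart_cod_open|exact: cod_chart].
Unshelve. all: by end_near. Qed.

(** The value at p of the fundamental vector field of X, in the chart c. *)
Definition orbit_diff X : 'rV[R]_n := 'd F (0, c p) (X, 0).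

Lemma act_coord_dom0 : U (0, c p).
Proof. by apply/isotropy_dom/isotropy0; exact: torus_exp0. Qed.

Lemma orbit_curve_diff X : is_derive (0 : R) (1 : R) (fun s => F (s *: X, c p)) (orbit_diff X).
Proof.
have h : is_derive (0 : R) (1 : R) (fun s : R => (s *: X, c p)) (X, 0 : 'rV[R]_n).
  rewrite (_ : (fun _ => _) = (fun s : R => (0, c p) + s *: (X, 0))).
    exact: is_derive_line.
  by apply/funext => s; congr pair; rewrite /= ?add0r// scaler0 addr0.
have := @is_derive_curve_comp _ _ _ F _ 0 _ _ h.
rewrite scale0r; apply; exact: (act_coord_diff act_smooth cA act_coord_dom0).
Qed.

Lemma orbit_curve_near X : \forall s \near (0 : R), U (s *: X, c p).
Proof.
have : {for (0 : R), continuous (fun s : R => (s *: X, c p))}.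
  apply: (@cvg_pair _ _ _ (nbhs (0 : R)) (nbhs ((0 : R) *: X)) (nbhs (c p)) _ _ _ (fun s => s *: X) (fun=> c p)).
    exact: scalel_continuous.
  exact: cvg_cst.
by apply; rewrite scale0r; exact: (act_coord_dom_near act_smooth act_coord_dom0).
Qed.

(** The torus is abelian: an element fixing p maps the orbit curve of X through
    p to itself. *)
Lemma orbit_diff_fixed X Y : G Y -> orbit_diff X *m iso_rep Y = orbit_diff X.
Proof.
move=> GY; rewrite mul_iso_rep.
have h := orbit_curve_diff X.
have dY : differentiable (fun y => F (Y, y)) (F (0 *: X, c p)).
  by rewrite scale0r (act_coord_fixed (isotropy0 (torus_exp0 R k))); exact: fiber_diff.
have := is_derive_curve_comp dY h.
rewrite scale0r (act_coord_fixed (isotropy0 (torus_exp0 R k))) => h'.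
rewrite -(@derive_val _ _ _ _ _ _ _ h') -(@derive_val _ _ _ _ _ _ _ h).
apply: near_eq_derive; near=> s => /=.
have Us : U (s *: X, c p) by near: s; exact: orbit_curve_near.
rewrite -act_coord_compose// !act_coordE// addrC torus_expD (actD act_action).
by rewrite GY.
Unshelve. all: by end_near. Qed.

Lemma isotropyMn X N : G X -> G (X *+ N).
Proof.
move=> GX; elim: N => [|N IH]; first by rewrite mulr0n; apply/isotropy0/torus_exp0.
by rewrite mulrS; exact: isotropyD.
Qed.

(** The matrix of [orbit_diff], so that the rank of the orbit map and its
    kernel make sense. *)
Definition orbit_mx : 'M[R]_(k, n) := jacobian (fun X => F (X, c p)) 0.

Lemma orbit_mxE X : X *m orbit_mx = orbit_diff X.
Proof.
have dp : differentiable (fun X : 'rV[R]_k => (X, c p)) 0.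
  by apply: differentiable_pair.
have dF := act_coord_diff act_smooth cA act_coord_dom0.
rewrite /orbit_mx /jacobian mul_rV_lin1.
have := congr1 (fun f => f X) (diff_comp dp dF) => /= ->.
by rewrite diff_pair//= diff_cst diff_val.
Qed.

(** By the group law, the velocity of the orbit curve at time t is the image of
    its velocity at time 0 under the differential of exp(tX), so it vanishes
    throughout. *)
Lemma orbit_curve_stationary X : (forall t : R, 0 <= t <= 1 -> U (t *: X, c p)) ->
  X *m orbit_mx = 0 -> G X.
Proof.
rewrite orbit_mxE => UX X0.
have dg (t : R) : 0 <= t <= 1 -> is_derive t (1 : R) (fun s => F (s *: X, c p)) 0.
  move=> /UX Ut; apply: (@is_derive_translate _ _ _ (fun h => F (t *: X + h *: X, c p))).
    by move=> h; rewrite scalerDl.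
  have [dt _] := fiber_diffP act_smooth cA 0 Ut.
  have h := orbit_curve_diff X.
  have p0 : F (0 *: X, c p) = c p.
    by rewrite scale0r (act_coord_fixed (isotropy0 (torus_exp0 R k))).
  rewrite -p0 in dt; have := is_derive_curve_comp dt h; rewrite X0 linear0.
  apply: near_eq_is_derive; near=> s => /=.
  rewrite act_coord_compose//; near: s; exact: orbit_curve_near.
have := @mean_value_rV _ _ (fun s => F (s *: X, c p)) (fun=> 0) 0 (lexx _) dg.
have -> : F (0 *: X, c p) = c p.
  by rewrite scale0r (act_coord_fixed (isotropy0 (torus_exp0 R k))).
rewrite scale1r normr0 => /(_ (fun _ _ => lexx _)); rewrite normr_le0 subr_eq0 => /eqP.
rewrite act_coordE// => e; have [|_ /=] := UX 1; first by rewrite ler01 lexx.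
by rewrite scale1r chartK// => d; rewrite /isotropy /= -(chartK d) e chartK.
Unshelve. all: by end_near. Qed.

(** [orbit_curve_stationary] applies to a small multiple of X, and the isotropy
    group is closed under sums. *)
Lemma orbit_kernel_isotropy X : X *m orbit_mx = 0 -> G X.
Proof.
move=> X0; have /nbhs_ballP[e /= e0 eU] := orbit_curve_near X.
have [N Ne] : exists N : nat, N.+1%:R^-1 < e.
  by have := near_infty_natSinv_lt (PosNum e0) => -[N _ /(_ N (leqnn _))]; exists N.
have -> : X = ((N.+1%:R^-1 : R) *: X) *+ N.+1.
  by rewrite -scaler_nat scalerA mulfV ?scale1r// pnatr_eq0.
apply: isotropyMn; apply: orbit_curve_stationary; last by rewrite -scalemxAl X0 scaler0.
move=> t /andP[t0 t1]; rewrite scalerA; apply: eU.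
rewrite /ball /= sub0r normrN ger0_norm ?mulr_ge0 ?invr_ge0//.
by apply: le_lt_trans Ne; rewrite ler_piMl ?invr_ge0.
Qed.

Lemma orbit_kernel_lie X : X *m orbit_mx = 0 <-> lie_algebra (isotropy act p) X.
Proof.
split=> [X0 s|GX].
  by apply: orbit_kernel_isotropy; rewrite -scalemxAl X0 scaler0.
rewrite orbit_mxE -(@derive_val _ _ _ _ _ _ _ (orbit_curve_diff X)).
rewrite (_ : (fun _ => _) = cst (c p)) ?derive_cst//.
by apply/funext => s; exact/act_coord_fixed/GX.
Qed.

End Isotropy.

(** * Faithfulness of the isotropy representation *)

Lemma continuous_near_value (R : realType) (V W : normedModType R) (f : V -> W) z w (e : R) :
  {for z, continuous f} -> f z = w -> 0 < e -> \forall z' \near z, `|f z' - w| < e.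
Proof.
by move=> cf <- e0; move/cvgrPdist_lt: cf => /(_ e e0); apply: filterS => y; rewrite distrC.
Qed.

Section Faithful.
Variables (R : realType) (k n : nat) (M : manifold R n) (act : torus R k -> M -> M).
Hypotheses (act_action : is_action act) (act_smooth : is_smooth act).
Implicit Types (X Y : 'rV[R]_k) (x y v : 'rV[R]_n).
Local Notation texp := (@torus_exp R k).

Lemma pair_cst_continuous (V W : topologicalType) (w : W) : continuous (fun v : V => (v, w)).
Proof.
move=> v; apply: (@cvg_pair _ _ _ (nbhs v) (nbhs v) (nbhs w) _ _ _ id (fun=> w)).
  exact: cvg_id.
exact: cvg_cst.
Qed.

Lemma cst_pair_continuous (V W : topologicalType) (w : W) : continuous (fun v : V => (w, v)).
Proof.
move=> v; apply: (@cvg_pair _ _ _ (nbhs v) (nbhs w) (nbhs v) _ _ _ (fun=> w) id).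
  exact: cvg_cst.
exact: cvg_id.
Qed.

Lemma act_exp_continuous p : continuous (fun X => act (texp X) p).
Proof.
move=> X; apply: (@continuous_comp _ _ _ (fun X => (texp X, p)) (fun w : torus R k * M => act w.1 w.2)); last exact: act_smooth.1.
apply: (@continuous_comp _ _ _ texp (fun t => (t, p))).
  exact: torus_exp_continuous.
exact: pair_cst_continuous.
Qed.

Section AtPoint.
Variables (c : chart R n M) (p : M).
Hypotheses (cA : atlas c) (cp : chart_dom c p).
Local Notation F := (act_coord act c).
Local Notation U := (act_coord_dom act c).
Local Notation G X := (isotropy act p (texp X)).

(** The kernel of the isotropy representation, pulled back to the Lie algebra.
    *)
Definition infinitesimal_stabilizer : set 'rV[R]_k :=
  [set X | G X /\ forall v, 'd F (X, c p) (0, v) = v].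

Lemma infinitesimal_stabilizerP X :
  infinitesimal_stabilizer X <-> G X /\ iso_rep act c p X = 1%:M.
Proof.
split=> -[GX h]; split=> //.
  apply/row_matrixP => i; rewrite !rowE mulmx1.
  by apply: etrans (iso_repE act_smooth cA cp _ GX) _.
by move=> v; rewrite -(iso_repE act_smooth cA cp v GX) h mulmx1.
Qed.

(** Outside the isotropy group the complement is open because M is Hausdorff;
    at points of the isotropy group the differential depends continuously on X.
    *)
Lemma infinitesimal_stabilizer_closed : closed infinitesimal_stabilizer.
Proof.
rewrite -openC openE => X nX; rewrite /interior /=.
have [GX|nGX] := pselect (G X); last first.
  have cX : {for X, continuous (fun X => act (texp X) p)}.
    exact: act_exp_continuous.
  have oM : open (~` [set p]).
    by rewrite openC; apply: accessible_closed_set1; apply: hausdorff_accessible; exact: manifold_hausdorff.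
  have : nbhs (act (texp X) p) (~` [set p]) by apply: open_nbhs_nbhs; split.
  move/cX => h; apply: (@filterS _ (nbhs X) _ _ _ _ h) => Y nY [GY _]; exact: nY.
have [v vX] : exists v : 'rV[R]_n, 'd F (X, c p) (0, v) <> v.
  apply: contra_notP nX => nv; split=> // v.
  by apply: contra_notP nv => h; exists v.
have cv : {for X, continuous (fun X => 'd F (X, c p) (0, v))}.
  apply: (@continuous_comp _ _ _ (fun X => (X, c p)) (fun z => 'd F z (0, v))).
    exact: pair_cst_continuous.
  apply: differentiable_continuous.
  exact: (act_coord_diff2 act_smooth cA (0, v) (isotropy_dom cp GX)).
have : nbhs ('d F (X, c p) (0, v)) (~` [set v]).
  apply: open_nbhs_nbhs; split=> //.
  rewrite openC; apply: accessible_closed_set1; apply: hausdorff_accessible.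
  exact: norm_hausdorff.
move/cv => h; apply: (@filterS _ (nbhs X) _ _ _ _ h) => Y nY [_ /(_ v)]; exact: nY.
Qed.

(** A compact set of representatives for the kernel of the isotropy
    representation. *)
Definition unit_cube_stabilizer : set 'rV[R]_k :=
  [set X : 'rV[R]_k | forall i, `[0, 1]%classic (X 0 i)] `&` infinitesimal_stabilizer.

Lemma unit_cube_stabilizer_compact : compact unit_cube_stabilizer.
Proof.
by apply: compact_closedI; [exact: unit_cube_compact|exact: infinitesimal_stabilizer_closed].
Qed.

(** By compactness, the differentials of all elements of the kernel of the
    isotropy representation are close to the identity on one common
    neighbourhood of p. *)
Lemma act_coord_near_translation : \forall x \near c p, forall X, unit_cube_stabilizer X ->
  U (X, x) /\ forall v, `|'d F (X, x) (0, v) - v| <= 2^-1 * `|v|.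
Proof.
(* A row v times a matrix with entries at most e has entries at most n e times
   the norm of v, and n e is below 1/2. *)
pose e : R := (2 * n.+1%:R)^-1.
have e0 : 0 < e by rewrite invr_gt0 mulr_gt0.
pose P x X := U (X, x) /\ forall i : 'I_n, `|'d F (X, x) (0, delta_mx 0 i) - delta_mx 0 i| < e.
have loc X : unit_cube_stabilizer X -> \forall X' \near X & x \near c p, P x X'.
  move=> [_ [GX DX]]; have UX := isotropy_dom cp GX.
  have near_i (i : 'I_n) : \forall z \near (X, c p), `|'d F z (0, delta_mx 0 i) - delta_mx 0 i| < e.
    have cd := differentiable_continuous (act_coord_diff2 act_smooth cA (0, delta_mx 0 i) UX).
    exact: (continuous_near_value cd (DX _) e0).
  have UXn := act_coord_dom_near act_smooth UX.
  have near_all : \forall z \near (X, c p), forall i : 'I_n, `|'d F z (0, delta_mx 0 i) - delta_mx 0 i| < e.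
    exact: (@filter_forall _ _ (fun (i : 'I_n) z => `|'d F z (0, delta_mx 0 i) - delta_mx 0 i| < e)
      (nbhs (X, c p)) _ near_i).
  have PE z : U z -> (forall i : 'I_n, `|'d F z (0, delta_mx 0 i) - delta_mx 0 i| < e) ->
      P z.2 z.1 by case: z.
  have bothP : \forall z \near (X, c p), P z.2 z.1.
    by near=> z; apply: PE; near: z.
  exact: bothP.
have near_P := (compact_near_coveringP _).1 unit_cube_stabilizer_compact _ _ P (nbhs_filter (c p)) loc.
apply: (@filterS _ (nbhs (c p)) _ _ _ _ near_P) => x KP X /KP[UX DX]; split=> // v.
have [_ ] := fiber_diffP act_smooth cA v UX => <-.
pose J := jacobian (fun y => F (X, y)) x.
have JE w : 'd (fun y => F (X, y)) x w = w *m J by rewrite /J /jacobian mul_rV_lin1.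
have Je i j : `|(J - 1%:M) i j| <= e.
  have := DX i; have [_ <-] := fiber_diffP act_smooth cA (delta_mx 0 i) UX.
  rewrite JE => /ltW; apply: le_trans; apply: le_trans (mx_entry_le_norm _ 0 j).
  by rewrite -rowE !mxE eqxx eq_sym.
rewrite JE -[X in _ - X]mulmx1 -mulmxBr; apply: mx_norm_le.
  by rewrite mulr_ge0// invr_ge0.
move=> i j; rewrite mxE; apply: le_trans (ler_norm_sum _ _ _) _.
apply: (@le_trans _ _ (\sum_(l < n) `|v| * e)).
  apply: ler_sum => l _; rewrite normrM ler_pM// ?mx_entry_le_norm//.
rewrite sumr_const card_ord -mulrnAr mulrC ler_wpM2r//.
rewrite /e -mulr_natr invfM -mulrA ger_pMr ?invr_gt0//.
by rewrite mulrC ler_pdivrMr// mul1r ler_nat.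
Unshelve. all: by end_near. Qed.

Lemma act_coord_near_isometry : exists2 r : R, 0 < r & forall X x y,
  unit_cube_stabilizer X -> ball (c p) r x -> ball (c p) r y ->
  U (X, x) /\ `|F (X, x) - F (X, y) - (x - y)| <= 2^-1 * `|x - y|.
Proof.
have /nbhs_ballP[r /= r0 near_r] := act_coord_near_translation.
exists r => // X x y KX xr yr; split; first by have [] := near_r x xr X KX.
have seg (t : R) : 0 <= t <= 1 -> ball (c p) r (y + t *: (x - y)).
  move=> /andP[t0 t1]; move: xr yr; rewrite -!ball_normE /= => xr yr.
  have -> : c p - (y + t *: (x - y)) = (1 - t) *: (c p - y) + t *: (c p - x).
    by apply/rowP => i; rewrite !mxE; ring.
  apply: le_lt_trans (ler_normD _ _) _; rewrite !normrZ (ger0_norm t0).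
  rewrite ger0_norm ?subr_ge0//.
  have [tle|tgt] := leP t 2^-1; nra.
(* The displacement along the segment from y to x. *)
pose f t : 'rV[R]_n := F (X, y + t *: (x - y)) - (y + t *: (x - y)).
have fd (t : R) : 0 <= t <= 1 -> is_derive t (1 : R) f
    ('d F (X, y + t *: (x - y)) (0, x - y) - (x - y)).
  move=> t01; have [UX _] := near_r _ (seg t t01) X KX.
  have [dt Dt] := fiber_diffP act_smooth cA (x - y) UX.
  have hl := is_derive_line y (x - y) t.
  have hF := is_derive_curve_comp (f := fun y => F (X, y)) dt hl.
  rewrite -Dt; exact: is_deriveB.
have e0 : 0 <= 2^-1 * `|x - y| by rewrite mulr_ge0// invr_ge0.
have := mean_value_rV e0 fd.
rewrite /f scale1r scale0r addr0 (addrC y (x - y)) subrK.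
have -> : F (X, x) - x - (F (X, y) - y) = F (X, x) - F (X, y) - (x - y).
  by apply/rowP => i; rewrite !mxE; ring.
by apply => t t01; have [_] := near_r _ (seg t t01) X KX; apply.
Qed.

Lemma infinitesimal_stabilizerMn X N : infinitesimal_stabilizer X ->
  infinitesimal_stabilizer (X *+ N).
Proof.
move=> /infinitesimal_stabilizerP[GX hX]; apply/infinitesimal_stabilizerP.
split; first exact: isotropyMn.
elim: N => [|N IH]; first by rewrite mulr0n; apply/iso_rep0/torus_exp0.
by rewrite mulrS iso_repD// ?hX ?IH ?mulmx1//; exact: isotropyMn.
Qed.

Lemma act_coord_ext X Y y : texp X = texp Y -> F (X, y) = F (Y, y).
Proof. by move=> XY; rewrite /act_coord /= XY. Qed.

Lemma infinitesimal_stabilizer_ext X Y : texp X = texp Y ->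
  infinitesimal_stabilizer X -> infinitesimal_stabilizer Y.
Proof.
move=> XY /infinitesimal_stabilizerP[GX hX]; apply/infinitesimal_stabilizerP.
split; first by rewrite -XY.
rewrite -hX /iso_rep; congr (jacobian _ _).
by apply/funext => y; rewrite (act_coord_ext y XY).
Qed.

(** Let y be the image of x under t = exp X. For every N, the transformation N
    t nearly preserves the vector y - x by [act_coord_near_isometry], so each
    step from N t x to (N+1) t x differs from y - x by at most half of its
    length, and N steps move x by at least N/2 times that length. But N t x
    stays at a bounded distance from x, so y = x. This replaces the
    linearization of compact group actions. *)
Lemma infinitesimal_stabilizer_near_fixed X : infinitesimal_stabilizer X ->
  \forall q \near p, act (texp X) q = q.
Proof.
move=> SX; have [GX _] := SX.
have [r r0 iso] := act_coord_near_isometry.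
have near_fix : \forall x \near c p, F (X, x) = x.
  near=> x.
  have xr : ball (c p) r x by near: x; exact: nbhsx_ballx.
  have yr : ball (c p) r (F (X, x)).
    near: x; have cF := differentiable_continuous (fiber_diff act_smooth cA cp GX).
    have bF : nbhs (F (X, c p)) (ball (c p) r).
      by rewrite (act_coord_fixed cp GX); exact: nbhsx_ballx.
    exact: (cF _ bF).
  have Ux : U (X, x) by near: x; exact: fiber_dom_near.
  have /choice[Y YP] : forall N, exists Y, unit_cube_stabilizer Y /\ texp Y = texp (X *+ N).
    move=> N; have [Y Yc YX] := torus_unit_cube (texp (X *+ N)).
    exists Y; split; last exact: YX.
    split; first exact: Yc.
    apply: infinitesimal_stabilizer_ext (esym YX) _.
    exact: infinitesimal_stabilizerMn.
  pose y := F (X, x).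
  have step N : F (Y N, y) = F (Y N.+1, x).
    rewrite (act_coord_ext _ (YP N).2) (act_coord_ext _ (YP N.+1).2) mulrSr.
    by rewrite (act_coord_compose act_action).
  have start : F (Y 0%N, x) = x.
    rewrite (act_coord_ext _ (YP 0%N).2) mulr0n /act_coord /= torus_exp0 (act0 act_action).
    by have [_ ->] := chart_cod_dom Ux.1.
  have bound N : `|F (Y N, x) - x - (y - x) *+ N| <= (2^-1 * `|y - x|) *+ N.
    elim: N => [|N IH]; first by rewrite start !mulr0n subrr subr0 normr0.
    rewrite -step !(mulrS _ N).
    have [_ isoN] := iso _ _ _ (YP N).1 yr xr.
    apply: (le_trans _ (lerD isoN IH)); apply: (le_trans _ (ler_normD _ _)).
    rewrite le_eqVlt; apply/orP; left; apply/eqP; congr (`|_|).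
    by apply/rowP => i; rewrite !mxE; ring.
  have bounded N : `|F (Y N, x) - x| <= 2^-1 * r.
    have [_] := iso _ _ _ (YP N).1 xr (ballxx (c p) r0).
    have -> : F (Y N, c p) = c p by apply: act_coord_fixed => //; have [_ []] := (YP N).1.
    rewrite (_ : F (Y N, x) - c p - (x - c p) = F (Y N, x) - x); last first.
      by rewrite opprB addrA subrK.
    move=> /le_trans; apply; rewrite ler_pM2l ?invr_gt0//.
  apply/eqP; rewrite -subr_eq0 -normr_eq0 -/y; apply/negPn/negP => d0.
  have {}d0 : 0 < `|y - x| by rewrite lt_def d0 normr_ge0.
  have small N : `|y - x| *+ N <= r.
    have h1 : `|y - x| *+ N <= `|F (Y N, x) - x - (y - x) *+ N| + `|F (Y N, x) - x|.
      rewrite -normrMn; apply: (le_trans _ (ler_normB _ _)).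
      rewrite le_eqVlt; apply/orP; left; apply/eqP; rewrite -[LHS]normrN; congr (`|_|).
      by apply/rowP => i; rewrite !mxE; ring.
    have := bound N; have := bounded N; move: h1.
    rewrite -mulrnAr; set a := `|_| *+ N; lra.
  have := small (Num.truncn (r / `|y - x|)).+1.
  rewrite -mulr_natr -ler_pdivlMl// mulrC leNgt => /negP; apply.
  exact: truncnS_gt.
have cdom : \forall q \near p, chart_dom c q.
  by apply: open_nbhs_nbhs; split; [exact: chart_dom_open|].
have Udom : \forall q \near p, U (X, c q).
  exact: (chart_map_continuous cp (fiber_dom_near act_smooth cp GX)).
have Ffix : \forall q \near p, F (X, c q) = c q.
  exact: (chart_map_continuous cp near_fix).
near=> q.
have cq : chart_dom c q by near: q.
have [_ /=] : U (X, c q) by near: q.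
have : F (X, c q) = c q by near: q.
by rewrite act_coordE// chartK// => e d; rewrite -(chartK d) e chartK.
Unshelve. all: by end_near. Qed.

End AtPoint.

Hypothesis M_connected : connected [set: M].

Lemma near_fixed_diff c (q : M) X v : atlas c -> chart_dom c q ->
  (\forall q' \near q, act (texp X) q' = q') -> 'd (act_coord act c) (X, c q) (0, v) = v.
Proof.
move=> cA cq Xq; have GX : isotropy act q (texp X) by exact: nbhs_singleton Xq.
have UX := isotropy_dom cq GX.
have [dF <-] := fiber_diffP act_smooth cA v UX.
have d1 : differentiable (@id 'rV[R]_n) (c q) by exact: ex_diff.
rewrite (near_eq_diff v dF d1); first by rewrite diff_val.
have cod : (c @` chart_dom c) (c q) by exists q.
have inv_fix : \forall y \near c q, act (texp X) (chart_inv c y) = chart_inv c y.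
  have Xq' : nbhs (chart_inv c (c q)) [set q' | act (texp X) q' = q'] by rewrite chartK.
  exact: (chart_inv_continuous cod Xq').
have cod_near : \forall y \near c q, (c @` chart_dom c) y.
  by apply: open_nbhs_nbhs; split; [exact: chart_cod_open|].
near=> y; rewrite /act_coord /= (_ : act _ _ = chart_inv c y); last by near: y.
by have [|_] := @chart_cod_dom _ _ _ c y; first by near: y.
Unshelve. all: by end_near. Qed.

(** The interior of the fixed point set of t is closed: at a limit point, t is
    fixed and its differential is the identity by continuity, so
    [infinitesimal_stabilizer_near_fixed] applies. *)
Lemma near_fixed_everywhere X (p : M) :
  (\forall q \near p, act (texp X) q = q) -> forall q, act (texp X) q = q.
Proof.
move=> Xp; pose A : set M := [set q : M | \forall q' \near q, act (texp X) q' = q'].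
suff AT : A = setT by move=> q; have : A q by [rewrite AT]; move/nbhs_singleton.
have oA : open A by rewrite openE => q Aq; exact: (near_join Aq).
apply: M_connected.
- by exists p.
- by exists A => //; rewrite setTI.
exists A; rewrite ?setTI//= => q clAq.
have cA := chart_at_atlas q; have cq := chart_at_dom q.
set c := chart_at q in cA cq.
have cact : {for q, continuous (act (texp X))}.
  apply: (@continuous_comp _ _ _ (fun q => (texp X, q)) (fun w : torus R k * M => act w.1 w.2)); last exact: act_smooth.1.
  exact: cst_pair_continuous.
have GX : isotropy act q (texp X).
  apply: (@manifold_hausdorff _ _ M) => B C nB nC.
  have nB' : nbhs q (act (texp X) @^-1` B) by exact: (cact _ nB).
  have [q' [Aq' [Bq' Cq']]] := clAq _ (filterI nB' nC).
  exists q'; split=> //; rewrite /= in Bq'.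
  by rewrite -(nbhs_singleton Aq').
apply: (infinitesimal_stabilizer_near_fixed cA cq); split=> // v.
apply: contrapT => nv.
pose f z := 'd (act_coord act c) z (0, v).
have cd : {for (X, c q), continuous f}.
  apply: differentiable_continuous.
  exact: (act_coord_diff2 act_smooth cA (0, v) (isotropy_dom cq GX)).
have nbv : nbhs (f (X, c q)) (~` [set v]).
  apply: open_nbhs_nbhs; split=> //.
  rewrite openC; apply: accessible_closed_set1; apply: hausdorff_accessible.
  exact: norm_hausdorff.
have cpair : {for q, continuous (fun q' => (X, c q'))}.
  apply: (@continuous_comp _ _ _ c (fun y => (X, y))); first exact: chart_map_continuous.
  exact: cst_pair_continuous.
have cf : {for q, continuous (fun q' => f (X, c q'))}.
  exact: (@continuous_comp _ _ _ (fun q' => (X, c q')) f).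
have near_nv : \forall q' \near q, f (X, c q') <> v.
  exact: (cf _ nbv).
have near_dom : \forall q' \near q, chart_dom c q'.
  by apply: open_nbhs_nbhs; split; [exact: chart_dom_open|].
have [q' [Aq' [nv' cq']]] := clAq _ (filterI near_nv near_dom).
exact/nv'/near_fixed_diff.
Qed.

(** An element acting trivially on a tangent space acts trivially near the
    point, hence on the connected manifold, hence is zero as the action is
    effective. *)
Lemma faithful_iso_rep c p X : atlas c -> chart_dom c p -> effective act ->
  isotropy act p (texp X) -> iso_rep act c p X = 1%:M -> texp X = 0.
Proof.
move=> cA cp eff GX hX; apply: eff; apply: near_fixed_everywhere (p) _.
by apply: (infinitesimal_stabilizer_near_fixed cA cp); apply/infinitesimal_stabilizerP.
Qed.
End Faithful.

(** * Isotropy groups of isotropic actions preserving a G2-structure *)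

(** The k conditions cut out a nonzero subspace of a space of dimension larger
    than k. *)
Lemma exists_unit_in_ortho (R : realType) (k m n : nat) (W : 'M[R]_(m, n)) (M : 'M[R]_(k, n)) :
  (k < \rank W)%N -> exists a : 'rV[R]_n,
  [/\ (a <= W)%MS, dot a a = 1 & forall i, dot (row i M) a = 0].
Proof.
move=> kW; pose B := row_base W.
have [y y1 yM] := exists_ortho (M *m B^T) kW.
have yB0 : y *m B != 0.
  apply/negP => /eqP yB; have y0 : y = 0.
    by apply: (row_free_inj (row_base_free W)); rewrite yB mul0mx.
  by move: y1; rewrite y0 dot0l => /esym/eqP; rewrite oner_eq0.
have [c cy1] := exists_unit yB0; exists (c *: (y *m B)); split=> //.
  by rewrite scalemx_sub// (submx_trans (submxMl _ _))// eq_row_base.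
move=> i; rewrite dotZr /dot trmx_mul mulmxA -row_mul -/(dot _ _) yM mulr0//.
Qed.

Section G2Action.
Variables (R : realType) (M : manifold R 7) (phi : field3 M) (act : torus R 3 -> M -> M).
Arguments phi : clear implicits.
Hypotheses (M_connected : connected [set: M]) (act_action : is_action act)
  (act_smooth : is_smooth act) (act_effective : effective act).
Hypothesis act_preserves : forall t, preserves (act t) phi.
Hypothesis orbits_isotropic : forall (p : M) (u v w : tangent p),
    orbit_tangent act p u -> orbit_tangent act p v -> orbit_tangent act p w ->
    phi p u v w = 0.
Variables (p : M) (A : 'M[R]_7).
Hypothesis Au : A \in unitmx.
Hypothesis phiA : forall u v w : 'rV[R]_7, phi p u v w = phi0 (u *m A) (v *m A) (w *m A).

Local Notation texp := (@torus_exp R 3).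
Local Notation c := (chart_at p).
Local Notation F := (act_coord act c).
Local Notation G X := (isotropy act p (texp X)).
Let cA : atlas c := chart_at_atlas p.
Let cp : chart_dom c p := chart_at_dom p.
Implicit Types X Y : 'rV[R]_3.

(** The charts used at the source and at the target of the tangent map agree
    when f fixes p, but only up to the equation f p = p. *)
Lemma tangent_map_isotropy (f : M -> M) (u v w : 'rV[R]_7) : f p = p ->
  phi (f p) (@tangent_map _ _ _ f p u) (@tangent_map _ _ _ f p v) (@tangent_map _ _ _ f p w) =
  phi p ('d (c \o f \o chart_inv c) (c p) u) ('d (c \o f \o chart_inv c) (c p) v)
    ('d (c \o f \o chart_inv c) (c p) w).
Proof.
move=> fp.
have gen r : r = p -> phi r ('d (chart_at r \o f \o chart_inv c) (c p) u)
    ('d (chart_at r \o f \o chart_inv c) (c p) v) ('d (chart_at r \o f \o chart_inv c) (c p) w) =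
  phi p ('d (c \o f \o chart_inv c) (c p) u) ('d (c \o f \o chart_inv c) (c p) v)
    ('d (c \o f \o chart_inv c) (c p) w) by move=> ->.
exact: (gen (f p) fp).
Qed.

Lemma iso_rep_preserves X (u v w : 'rV[R]_7) : G X ->
  phi p (u *m iso_rep act c p X) (v *m iso_rep act c p X) (w *m iso_rep act c p X) =
  phi p u v w.
Proof.
move=> GX; rewrite -(act_preserves (texp X) u v w) (tangent_map_isotropy _ _ _ GX).
by congr (phi p _ _ _); apply: mul_iso_rep.
Qed.

Lemma fundamental_fieldE X : fundamental_field act X p = X *m orbit_mx act c p.
Proof.
rewrite (orbit_mxE act_action act_smooth cA cp) /fundamental_field derive1E.
have h := orbit_curve_diff act_action act_smooth cA cp X.
have e : (fun s : R => F (s *: X, c p)) = (fun s : R => c (act (texp (s *: X)) p)).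
  by apply/funext => s; exact: (act_coordE act _ cp).
rewrite e in h; exact: (@derive_val _ _ _ _ _ _ _ h).
Qed.

Lemma orbit_tangentE X : orbit_tangent act p (X *m orbit_mx act c p).
Proof.
exists 1%N, (fun=> 1), (fun=> X); rewrite big_ord_recl big_ord0 addr0 scale1r.
by rewrite fundamental_fieldE.
Qed.

(** The isotropy representation in the frame A, in which phi is the standard
    form phi0. *)
Definition G2_rep X : 'M[R]_7 := invmx A *m iso_rep act c p X *m A.

Definition iso_image : set 'M[R]_7 := [set g | exists2 X, G X & g = G2_rep X].

(** Its rows span the tangent space of the orbit, in the frame A. *)
Definition orbit_frame : 'M[R]_(3, 7) := orbit_mx act c p *m A.

Lemma iso_image_G2 g : iso_image g -> in_G2 g.
Proof.
move=> [X GX ->] u v w; rewrite /G2_rep !mulmxA -phiA iso_rep_preserves//.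
by rewrite phiA !mulmxKV.
Qed.

Lemma G2_repD X Y : G X -> G Y ->
  G2_rep (X + Y) = G2_rep Y *m G2_rep X.
Proof.
move=> GX GY; rewrite /G2_rep (iso_repD act_action act_smooth cA cp GX GY).
by rewrite !mulmxA mulmxK.
Qed.

Lemma iso_image_comm g h : iso_image g -> iso_image h -> g *m h = h *m g.
Proof.
move=> [X GX ->] [Y GY ->]; apply: etrans (esym (G2_repD GY GX)) _.
by rewrite (addrC Y X); exact: (G2_repD GX GY).
Qed.

Lemma orbit_frame_fixed (u : 'rV[R]_7) g : (u <= orbit_frame)%MS -> iso_image g -> u *m g = u.
Proof.
move=> /submxP[X ->] [Y GY ->]; rewrite /orbit_frame /G2_rep !mulmxA mulmxK//.
rewrite (orbit_mxE act_action act_smooth cA cp).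
by rewrite (orbit_diff_fixed act_action act_smooth cA cp).
Qed.

Lemma orbit_frame_isotropic (u v w : 'rV[R]_7) : (u <= orbit_frame)%MS -> (v <= orbit_frame)%MS ->
  (w <= orbit_frame)%MS -> phi0 u v w = 0.
Proof.
move=> /submxP[X ->] /submxP[Y ->] /submxP[Z ->]; rewrite /orbit_frame !mulmxA -phiA.
by apply: orbits_isotropic; exact: orbit_tangentE.
Qed.

Lemma G2_rep_faithful X : G X -> G2_rep X = 1%:M -> texp X = 0.
Proof.
move=> GX h; apply: (faithful_iso_rep act_action act_smooth M_connected cA cp act_effective GX).
have := congr1 (fun B => A *m B *m invmx A) h.
by rewrite /G2_rep !mulmxA mulmxV// mul1mx mulmxK// mulmx1 mulmxV.
Qed.

Lemma G2_rep_exp0 X : texp X = 0 -> G2_rep X = 1%:M.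
Proof.
by move=> X0; rewrite /G2_rep (iso_rep0 act_action act_smooth cA cp X0) mulmx1 mulVmx.
Qed.

Section Characters.
(** The isotropy group fixes u and acts on the complex lines of the vectors
    ws j, for the complex structure [cross u], by characters which determine it. *)
Variables (m : nat) (u : 'rV[R]_7) (ws : 'I_m -> 'rV[R]_7).
Hypotheses (u1 : dot u u = 1) (uS : forall g, iso_image g -> u *m g = u).
Hypothesis w1 : forall j, dot (ws j) (ws j) = 1.
Hypothesis uw : forall j, dot u (ws j) = 0.
Hypothesis wS : forall j, G2_eigenvector iso_image u (ws j).
Hypothesis rigid : forall g, iso_image g -> (forall j, ws j *m g = ws j) -> g = 1%:M.
Hypothesis rank_ker : (m <= \rank (kermx (orbit_mx act c p)))%N.

Definition char_re j X : R := dot (ws j *m G2_rep X) (ws j).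

Definition char_im j X : R := dot (ws j *m G2_rep X) (cross u (ws j)).

Lemma char_decomp j X : G X ->
  ws j *m G2_rep X = char_re j X *: ws j + char_im j X *: cross u (ws j).
Proof.
move=> GX; rewrite /char_re /char_im.
have [|a [b ->]] := wS j (g := G2_rep X); first by exists X.
rewrite !dotDl !dotZl w1 dot_cross_cross u1 w1 uw dot_crossr (dotC (ws j)) dot_crossr.
by rewrite !mulr0 !mulr1 subr0 mulr1 addr0 add0r.
Qed.

Lemma char_decomp_cross j X : G X -> cross u (ws j) *m G2_rep X =
  char_re j X *: cross u (ws j) - char_im j X *: ws j.
Proof.
move=> GX; have Sg : iso_image (G2_rep X) by exists X.
rewrite -(G2_cross (iso_image_G2 Sg)) uS// char_decomp// crossDr !crossZr.
by rewrite cross_cross uw u1 scale0r sub0r scale1r scalerN.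
Qed.

Lemma char_vec_orth j : dot (ws j) (cross u (ws j)) = 0.
Proof. by rewrite dotC dot_crossr. Qed.

Lemma char_vec_cross j : dot (cross u (ws j)) (cross u (ws j)) = 1.
Proof. by rewrite dot_cross_cross u1 w1 uw mulr0 subr0 mulr1. Qed.

Lemma char_mul j X Y : G X -> G Y -> ws j *m G2_rep (X + Y) =
  (char_re j X * char_re j Y - char_im j X * char_im j Y) *: ws j +
  (char_im j X * char_re j Y + char_re j X * char_im j Y) *: cross u (ws j).
Proof.
move=> GX GY; rewrite G2_repD// mulmxA (char_decomp j GY) mulmxDl -!scalemxAl.
rewrite (char_decomp j GX) (char_decomp_cross j GX).
move: (char_re j X) (char_im j X) (char_re j Y) (char_im j Y) => a b a' b'.
by apply/rowP => i; rewrite !mxE; ring.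
Qed.

Lemma char_reD j X Y : G X -> G Y ->
  char_re j (X + Y) = char_re j X * char_re j Y - char_im j X * char_im j Y.
Proof.
move=> GX GY; rewrite [LHS]/char_re (char_mul j GX GY) dotDl !dotZl w1 (dotC _ (ws j)) char_vec_orth.
by rewrite mulr1 mulr0 addr0.
Qed.

Lemma char_imD j X Y : G X -> G Y ->
  char_im j (X + Y) = char_im j X * char_re j Y + char_re j X * char_im j Y.
Proof.
move=> GX GY; rewrite [LHS]/char_im (char_mul j GX GY) dotDl !dotZl char_vec_cross char_vec_orth.
by rewrite mulr1 mulr0 add0r.
Qed.

Lemma char_norm j X : G X -> char_re j X ^+ 2 + char_im j X ^+ 2 = 1.
Proof.
move=> GX; have Sg : iso_image (G2_rep X) by exists X.
have := G2_dot (iso_image_G2 Sg) (ws j) (ws j); rewrite (char_decomp j GX) w1 => <-.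
rewrite !dotDl !dotDr !dotZl !dotZr w1 char_vec_cross char_vec_orth (dotC _ (ws j)) char_vec_orth.
by move: (char_re j X) (char_im j X) => a b; ring.
Qed.

Lemma char_re0 j X : texp X = 0 -> char_re j X = 1.
Proof. by move=> X0; rewrite /char_re G2_rep_exp0// mulmx1. Qed.

Lemma char_faithful X : G X -> (forall j, char_re j X = 1 /\ char_im j X = 0) -> texp X = 0.
Proof.
move=> GX h; apply: G2_rep_faithful => //; apply: rigid; first by exists X.
by move=> j; rewrite (char_decomp j GX); have [-> ->] := h j; rewrite scale1r scale0r addr0.
Qed.

(** A matrix coefficient of the isotropy representation, extended from the
    isotropy group to all of R^3 by the differential of the action; the
    extension is what can be differentiated. *)
Definition char_fun (w q : 'rV[R]_7) X : R := dot ('d F (X, c p) (0, w *m invmx A) *m A) q.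

Lemma char_funE w q X : G X -> dot (w *m G2_rep X) q = char_fun w q X.
Proof.
move=> GX; rewrite /char_fun /G2_rep !mulmxA; congr (dot (_ *m A) q).
exact: (iso_repE act_smooth cA cp _ GX).
Qed.

Lemma char_fun_diff w q : differentiable (char_fun w q) 0.
Proof.
have d1 : differentiable (fun X : 'rV[R]_3 => (X, c p)) 0.
  by apply: differentiable_pair.
pose f z := 'd F z (0, w *m invmx A).
have d2 : differentiable f (0, c p).
  apply: (act_coord_diff2 act_smooth cA); exact: act_coord_dom0.
have d3 : differentiable (f \o (fun X : 'rV[R]_3 => (X, c p))) 0.
  exact: differentiable_comp.
pose g (y : 'rV[R]_7) := y *m (A *m q^T).
have d4 : differentiable (g \o (f \o (fun X : 'rV[R]_3 => (X, c p)))) 0.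
  by apply: differentiable_comp => //; exact: mulmxr_differentiable.
have -> : char_fun w q = (fun y : 'M[R]_1 => y 0 0) \o (g \o (f \o (fun X : 'rV[R]_3 => (X, c p)))).
  by apply/funext => X; rewrite /char_fun /dot /g /= mulmxA.
by apply: differentiable_comp => //; exact: differentiable_coord.
Qed.

Lemma char_fun_line w q X :
  is_derive (0 : R) (1 : R) (fun s : R => char_fun w q (s *: X)) ('d (char_fun w q) 0 X).
Proof.
have hl := is_derive_line 0 X (0 : R).
have d : differentiable (char_fun w q) (0 + (0 : R) *: X).
  by rewrite scale0r addr0; exact: char_fun_diff.
have e : (char_fun w q \o (fun s : R => 0 + s *: X)) = (fun s : R => char_fun w q (s *: X)).
  by apply/funext => s; rewrite /comp add0r.
have e0 : 0 + (0 : R) *: X = 0 by rewrite scale0r addr0.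
have h := is_derive_curve_comp d hl; rewrite e e0 in h; exact: h.
Qed.

(** The derivatives of the characters at 0, in turns: division by 2 pi makes
    the lattice of the kernel integral. *)
Definition char_mx : 'M[R]_(3, m) :=
  \matrix_(i, j) ('d (char_fun (ws j) (cross u (ws j))) 0 (delta_mx 0 i) / (2 * pi)).

Lemma char_mxE X j : 2 * pi * (X *m char_mx) 0 j = 'd (char_fun (ws j) (cross u (ws j))) 0 X.
Proof.
have p0 : 2 * pi != 0 :> R by rewrite mulf_neq0// gt_eqF// pi_gt0.
rewrite mxE [in RHS](row_sum_delta X) linear_sum mulr_sumr; apply: eq_bigr => i _.
by rewrite mxE linearZ /= mulrCA [2 * pi * _]mulrC mulfVK.
Qed.

(** Along the line of X in the Lie algebra, the character is a one-parameter
    group of rotations. *)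
Lemma char_turn j X : X *m orbit_mx act c p = 0 ->
  char_re j X = turn_cos ((X *m char_mx) 0 j) /\ char_im j X = turn_sin ((X *m char_mx) 0 j).
Proof.
move=> XL; have GX s : G (s *: X).
  by apply: (orbit_kernel_isotropy act_action act_smooth cA cp); rewrite -scalemxAl XL scaler0.
have h1 := char_fun_line (ws j) (ws j) X.
have h2 := char_fun_line (ws j) (cross u (ws j)) X.
have e1 : (fun s : R => char_re j (s *: X)) = (fun s : R => char_fun (ws j) (ws j) (s *: X)).
  by apply/funext => s; exact: char_funE.
have e2 : (fun s : R => char_im j (s *: X)) = (fun s : R => char_fun (ws j) (cross u (ws j)) (s *: X)).
  by apply/funext => s; exact: char_funE.
rewrite -e1 in h1; rewrite -e2 -char_mxE in h2.
have := @one_parameter_circle _ (fun s => char_re j (s *: X)) (fun s => char_im j (s *: X)) _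
  _ _ _ _ _ h2 1.
rewrite scale1r mulr1; apply.
- by move=> s t; rewrite scalerDl char_reD.
- by move=> s t; rewrite scalerDl char_imD.
- by move=> s; exact: char_norm.
- by rewrite scale0r char_re0// torus_exp0.
- exact: (@ex_derive _ _ _ _ _ _ _ h1).
Qed.

Lemma isotropy_structure : [/\ connected (isotropy act p), lie_dim (isotropy act p) m &
  isomorphic_to_torus (isotropy act p) m].
Proof.
apply: (@torus_structure R 3 m 7 (isotropy act p) (orbit_mx act c p) char_mx char_re char_im).
- by move=> s t; rewrite /isotropy /= (actD act_action) => sp ->.
- by move=> X; exact: (orbit_kernel_isotropy act_action act_smooth cA cp).
- by move=> X; exact: (orbit_kernel_lie act_action act_smooth cA cp X).2.
- exact: rank_ker.
- by move=> j X /(char_turn j)[].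
- by move=> j X /(char_turn j)[].
- by move=> j X Y; exact: char_reD.
- by move=> j X Y; exact: char_imD.
- by move=> j X; exact: char_norm.
- by move=> j X; exact: char_re0.
- exact: char_faithful.
Qed.

End Characters.
Lemma rank_orbit_kernel : \rank (kermx (orbit_mx act c p)) = (3 - \rank orbit_frame)%N.
Proof. by rewrite mxrank_ker /orbit_frame mxrankMfree// row_free_unit. Qed.

(** If the orbit map has rank 0 the whole torus fixes p, and tori are
    divisible. *)
Lemma iso_image_sqrt : \rank orbit_frame = 0%N ->
  forall g, iso_image g -> exists2 h, iso_image h & h *m h = g.
Proof.
move=> r0 _ [X _ ->]; have L0 : orbit_mx act c p = 0.
  apply/eqP; rewrite -mxrank_eq0 -(mxrankMfree _ (_ : row_free A)) ?row_free_unit//.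
  exact/eqP.
have GX Y : G Y.
  by apply: (orbit_kernel_isotropy act_action act_smooth cA cp); rewrite L0 mulmx0.
exists (G2_rep (2^-1 *: X)); first by exists (2^-1 *: X).
apply: etrans (esym (G2_repD (GX _) (GX _))) _; congr G2_rep.
by rewrite -scalerDl -div1r -splitr scale1r.
Qed.

(** The orbit has dimension r, and the isotropy group has dimension 3 - r. It
    fixes the tangent space of the orbit. If r is 0 or 1 it fixes a unit vector
    u, and two characters on a frame (u, v, w) determine it. If r = 2 it fixes
    u and v, and one character is enough. If r = 3 it fixes an orthonormal
    basis u, v, w of the tangent space of the orbit; this is a G2 triple
    because phi vanishes on it, so the group is trivial. For r = 0 the two
    characters would embed the Lie algebra R^3 in R^2, so [isotropy_structure]
    excludes this case along the way. *)
Lemma isotropy_cases :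
  [/\ connected (isotropy act p),
      exists2 d : nat, lie_dim (isotropy act p) d & (d <= 2)%N
    & isotropy act p = [set 0]
      \/ isomorphic_to_torus (isotropy act p) 1
      \/ isomorphic_to_torus (isotropy act p) 2].
Proof.
have rk := rank_orbit_kernel; set r := \rank orbit_frame in rk.
have r3 : (r <= 3)%N by exact: rank_leq_row.
have fixed_eig u v : (v <= orbit_frame)%MS -> G2_eigenvector iso_image u v.
  move=> vN g Sg; exists 1, 0; rewrite scale1r scale0r addr0.
  exact: orbit_frame_fixed.
have [r1|r1] := leqP r 1.
  have [u u1 Su] : exists2 u : 'rV[R]_7, dot u u = 1 & forall g, iso_image g -> u *m g = u.
    have [r0|r0] := posnP r.
      exact: G2_exists_fixed iso_image_G2 iso_image_comm (iso_image_sqrt r0).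
    have [u [uN u1 _]] := exists_unit_in_ortho (0 : 'M[R]_(0, 7)) r0.
    by exists u => // g; exact: orbit_frame_fixed.
  have [v [w [uvw Sv Sw]]] := G2_frame_exists iso_image_G2 iso_image_comm u1 Su.
  have [[_ v1 w1] [uv uw _] _] := uvw.
  have [|||||Hc Hd Hi] := @isotropy_structure 2 u (fun j => if j == 0 then v else w) u1 Su.
  - by move=> j; case: ifP.
  - by move=> j; case: ifP.
  - by move=> j; case: ifP.
  - move=> g Sg fx; apply: (G2_triple_rigid (iso_image_G2 Sg) uvw (Su g Sg)).
      exact: (fx 0).
    exact: (fx 1).
  - by rewrite rk; case: (r) r1 => [|[]].
  by split=> //; [exists 2%N|right; right].
have [u [uN u1 _]] := exists_unit_in_ortho (0 : 'M[R]_(0, 7)) (ltnW r1 : (0 < r)%N).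
have Su g : iso_image g -> u *m g = u by exact: orbit_frame_fixed.
have [v [vN v1 uv]] := exists_unit_in_ortho u r1.
have {}uv : dot u v = 0 by have := uv 0; rewrite row_id.
have [r2|r2] := leqP r 2.
  have [w uvw Sw] := G2_frame_extend iso_image_G2 iso_image_comm u1 Su v1 uv (fixed_eig u v vN).
  have [[_ _ w1] [_ uw _] _] := uvw.
  have [|||||Hc Hd Hi] := @isotropy_structure 1 u (fun=> w) u1 Su => //.
  - move=> g Sg fx; apply: (G2_triple_rigid (iso_image_G2 Sg) uvw (Su g Sg)).
      exact: orbit_frame_fixed.
    exact: (fx 0).
  - by rewrite rk; case: (r) r2 => [|[|[]]].
  by split=> //; [exists 1%N|right; left].
have [w [wN w1 uvw0]] := exists_unit_in_ortho (\matrix_(i < 2) nth 0 [:: u; v] i) r2.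
have uvw : G2_triple u v w.
  have uw := uvw0 0; have vw := uvw0 1; rewrite !rowK /= in uw vw.
  split=> //; rewrite dot_cross; exact: orbit_frame_isotropic.
pose ws (j : 'I_0) : 'rV[R]_7 := 0.
have rigid g : iso_image g -> (forall j, ws j *m g = ws j) -> g = 1%:M.
  move=> Sg _; apply: (G2_triple_rigid (iso_image_G2 Sg) uvw (Su g Sg));
  exact: orbit_frame_fixed.
have [|||||Hc Hd Hi] := @isotropy_structure 0 u ws u1 Su => //; try by case.
split=> //; first by exists 0%N.
left; apply/seteqP; split=> [t tp|_ ->]; last exact: act0.
have Gt : G (repr t) by rewrite torus_exp_repr.
rewrite /= -(torus_exp_repr t); apply: G2_rep_faithful => //.
by apply: rigid => [|[]//]; exists (repr t).
Qed.

End G2Action.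

Unset Implicit Arguments.

Theorem lemma2p6 (R : realType) (M : manifold R 7) (phi : field3 M)
  (act : torus R 3 -> M -> M)
  (M_connected : connected [set: M])
  (phi_G2 : G2_structure phi)
  (act_action : is_action act)
  (act_smooth : is_smooth act)
  (act_effective : effective act)
  (act_preserves : forall t : torus R 3, preserves (act t) phi)
  (orbits_isotropic : forall (p : M) (u v w : tangent p),
    orbit_tangent act p u -> orbit_tangent act p v -> orbit_tangent act p w ->
    phi p u v w = 0)
  (p : M) :
  [/\ connected (isotropy act p),
      exists2 d : nat, lie_dim (isotropy act p) d & (d <= 2)%N
    & isotropy act p = [set 0]
      \/ isomorphic_to_torus (isotropy act p) 1
      \/ isomorphic_to_torus (isotropy act p) 2].
Proof.
have [_ /(_ p)[A Au phiA]] := phi_G2.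
exact: (isotropy_cases M_connected act_action act_smooth act_effective
  act_preserves orbits_isotropic Au phiA).
Qed.
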